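(* Let $P$ be a treetope with base $B$. Then the edges of $P$ not contained in $B$, together with all vertices of $P$, form a tree $T$ (the canopy). The nonempty faces of $P$ are partitioned into the following three classes: (1) the nonempty faces of $B$; (2) the vertices and edges of $P$ that are disjoint from $B$; (3) for each nonempty face $F$ of $B$ of dimension $i$, exactly one face $F'$ of $P$ of dimension $i+1$ with $F'\ne F$ and $F'\cap B=F$ (the lift of $F$). Moreover, for each face $F$ of $B$ with $\dim F\ge 1$, its lift $F'$ is a treetope with base $F$, and the canopy of $F'$ is the minimal subtree of $T$ containing all vertices of $F$.
   Context: A polytope is the convex hull of a finite set of points in a Euclidean space; faces, vertices, edges, facets and the graph (1-skeleton) are as usual. A \emph{treetope} is a polytope $P$ together with a distinguished facet $B$ (the \emph{base}) such that every face $F$ of $P$ whose intersection $F\cap B$ consists of at most one point has dimension at most one. The \emph{canopy} of a treetope $P$ with base $B$ is the graph whose vertices are the vertices of $P$ and whose edges are the edges of $P$ not contained in $B$. *)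

(* Defs.v *)
From HB Require Import structures.
From mathcomp Require Import all_boot all_order all_algebra.
Set Implicit Arguments. Unset Strict Implicit. Unset Printing Implicit Defensive.
Import Order.TTheory GRing.Theory Num.Theory.
Local Open Scope ring_scope.

Section Polytopes.
Variables (R : realFieldType) (n : nat).

Definition pset := 'rV[R]_n -> Prop.

Definition prel := 'rV[R]_n -> 'rV[R]_n -> Prop.

Definition seteq (A B : pset) : Prop := forall x, A x <-> B x.
Definition subsetP (A B : pset) : Prop := forall x, A x -> B x.
Definition inter (A B : pset) : pset := fun x => A x /\ B x.
Definition nonempty (A : pset) : Prop := exists x, A x.

Definition dotv (a x : 'rV[R]_n) : R := \sum_(i < n) a ord0 i * x ord0 i.

Definition conv (S : seq 'rV[R]_n) : pset := fun x =>
  exists w : 'I_(size S) -> R,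
    (forall i, 0 <= w i) /\ \sum_i w i = 1 /\ x = \sum_i w i *: nth 0 S i.

Definition polytope (P : pset) : Prop := exists S, seteq P (conv S).

(* faces of P: intersections with supporting hyperplanes (incl. empty and P) *)
Definition isFace (P F : pset) : Prop :=
  exists (a : 'rV[R]_n) (b : R),
    (forall x, P x -> dotv a x <= b) /\
    seteq F (fun x => P x /\ dotv a x = b).

(* F nonempty with affine hull x0 + rowspace Y, Y of full row rank k *)
Definition affdim (F : pset) (k : nat) : Prop :=
  exists x0, F x0 /\ exists Y : 'M[R]_(k, n),
    (forall i, F (x0 + row i Y)) /\ row_free Y /\
    (forall x, F x -> (x - x0 <= Y)%MS).

Definition hasDim (F : pset) (d : int) : Prop :=
  (d = -1 /\ ~ nonempty F) \/ (exists k : nat, d = k%:Z /\ affdim F k).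

Definition isVertex (P : pset) (v : 'rV[R]_n) : Prop := isFace P (fun x => x = v).
Definition isEdge (P E : pset) : Prop := isFace P E /\ hasDim E 1.

Definition isFacet (P B : pset) : Prop :=
  isFace P B /\ exists d, hasDim P d /\ hasDim B (d - 1).

Definition atMostOnePoint (A : pset) : Prop := forall x y, A x -> A y -> x = y.

Definition treetope (P B : pset) : Prop :=
  polytope P /\ isFacet P B /\
  forall F, isFace P F -> atMostOnePoint (inter F B) ->
    exists d, hasDim F d /\ d <= 1.

Fixpoint walk (E : prel) (x : 'rV[R]_n) (s : seq 'rV[R]_n)
  : Prop :=
  match s with
  | [::] => True
  | y :: s' => E x y /\ walk E y s'
  end.

Definition isGraph (V : pset) (E : prel) : Prop :=
  (forall u v, E u v -> V u /\ V v) /\ (forall u v, E u v -> E v u) /\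
  (forall u, ~ E u u).

Definition connectedG (V : pset) (E : prel) : Prop :=
  forall u v, V u -> V v -> exists s, walk E u s /\ last u s = v.

Definition acyclicG (E : prel) : Prop :=
  ~ exists x s, uniq (x :: s) /\ (2 <= size s)%N /\ walk E x s /\ E (last x s) x.

Definition isTree (V : pset) (E : prel) : Prop :=
  nonempty V /\ isGraph V E /\ connectedG V E /\ acyclicG E.

Definition subgraph (V1 : pset) (E1 : prel) (V2 : pset) (E2 : prel) : Prop :=
  subsetP V1 V2 /\ forall u v, E1 u v -> E2 u v.

Definition isMinSubtree (V : pset) (E : prel) (X : pset) (VS : pset) (ES : prel) : Prop :=
  subgraph VS ES V E /\ isTree VS ES /\ subsetP X VS /\
  forall (V' : pset) (E' : prel), subgraph V' E' V E -> isTree V' E' -> subsetP X V' ->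
    subgraph VS ES V' E'.

Definition canopyV (P : pset) : pset := isVertex P.
Definition canopyE (P B : pset) (u v : 'rV[R]_n) : Prop :=
  isVertex P u /\ isVertex P v /\ isEdge P (conv [:: u; v]) /\
  ~ subsetP (conv [:: u; v]) B.

Definition isLift (P B F G : pset) : Prop :=
  isFace P G /\ ~ seteq G F /\ seteq (inter G B) F /\
  exists i, hasDim F i /\ hasDim G (i + 1).

End Polytopes.

(* Main.v *)
Require Import Defs.
From HB Require Import structures.
From mathcomp Require Import all_boot all_order all_algebra.
From mathcomp Require Import ring lra.
From Stdlib Require Import Classical.
(* fintype shadows [subsetP]. *)
Import Defs.
Set Implicit Arguments. Unset Strict Implicit. Unset Printing Implicit Defensive.
Import Order.TTheory GRing.Theory Num.Theory.
Local Open Scope ring_scope.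

(** Let h >= 0 be the height above the base.  Fix a vertex v and a linear g
    with g(y - v) <= 0 for y in B.  If two edges at v went up along g in
    different directions, a one-parameter family of supporting functionals at v
    would have a member whose face contains v, goes strictly up along g away
    from v, and has dimension at least 2.  Such a face meets B in at most v,
    against the treetope condition; so at most one edge at v goes up along g.

    - No cycles: at a lowest vertex of a canopy cycle take g = h (perturbed if
      the vertex is off B); both edges of the cycle would go up.
    - Connectedness: the simplex method towards a highest vertex u0.  With w
      strictly maximal at u0, the objective is h / (w(u0) - w), which is linear
      after normalising at the current vertex and never leads back into B.
    - Dimensions: at a vertex v of B the only upward direction is that of the
      unique canopy edge vp, so P lies in the affine span of B and p.  Applied
      to a face G with base G /\ B, this gives the dimension of a lift and its
      uniqueness; a lift of F exists by tilting a functional of F by h.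
    - Minimality: from each end of a canopy edge uv of the lift, the simplex
      method leads down to F avoiding the other end; a subtree of T containing
      the vertices of F but not uv would then close a cycle. *)

Lemma seq_argmin (R : realFieldType) (T : eqType) (f : T -> R) (s : seq T) x :
  x \in s -> exists2 m, m \in s & forall y, y \in s -> f m <= f y.
Proof.
elim: s x => // z [|z' s] IH x.
  by move=> _; exists z; rewrite ?mem_head // => y; rewrite inE => /eqP->.
move=> _; have [m ms mP] := IH z' (mem_head _ _).
have [zm|mz] := leP (f z) (f m).
  exists z; rewrite ?mem_head // => y; rewrite inE => /predU1P[->//|/mP].
  exact: le_trans.
exists m; first by rewrite inE ms orbT.
by move=> y; rewrite inE => /predU1P[->|/mP//]; apply: ltW.
Qed.

(** * Dot products, convex hulls, faces and vertices *)

Section Polytopes.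
Variables (R : realFieldType) (n : nat).
Local Notation V := 'rV[R]_n.
Implicit Types (S T : seq V) (P F G B C : pset R n) (a c g x y v u s : V).

Lemma dotvC a x : dotv a x = dotv x a.
Proof. by apply: eq_bigr => i _; rewrite mulrC. Qed.

Lemma dotvDr a x y : dotv a (x + y) = dotv a x + dotv a y.
Proof. by rewrite -big_split; apply: eq_bigr => i _; rewrite mxE mulrDr. Qed.

Lemma dotvZr a k x : dotv a (k *: x) = k * dotv a x.
Proof. by rewrite mulr_sumr; apply: eq_bigr => i _; rewrite mxE mulrCA. Qed.

Lemma dotvNr a x : dotv a (- x) = - dotv a x.
Proof. by rewrite -scaleN1r dotvZr mulN1r. Qed.

Lemma dotvDl a c x : dotv (a + c) x = dotv a x + dotv c x.
Proof. by rewrite ![dotv _ x]dotvC dotvDr. Qed.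

Lemma dotvZl a k x : dotv (k *: a) x = k * dotv a x.
Proof. by rewrite ![dotv _ x]dotvC dotvZr. Qed.

Lemma dotvNl a x : dotv (- a) x = - dotv a x.
Proof. by rewrite ![dotv _ x]dotvC dotvNr. Qed.

Lemma dotv0r a : dotv a 0 = 0.
Proof. by rewrite -(scale0r 0) dotvZr mul0r. Qed.

Definition dotvE := (dotvDl, dotvDr, dotvNl, dotvNr, dotvZl, dotvZr).

Lemma dotv_gt0 x : x != 0 -> 0 < dotv x x.
Proof.
move=> x0; rewrite lt_neqAle sumr_ge0 ?andbT; last by move=> i _; apply: sqr_ge0.
apply: contra x0 => /eqP/esym/psumr_eq0P h; apply/eqP/rowP => i; rewrite mxE.
by apply/eqP; rewrite -sqrf_eq0 expr2 h // => j _; apply: sqr_ge0.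
Qed.

(** The columns of [cokermx Y] are themselves functionals that vanish on the rows of [Y], and
    together they detect the row space. *)
Lemma dotv_cokermx m (Y : 'M[R]_(m, n)) x :
  (forall c, (forall i, dotv c (row i Y) = 0) -> dotv c x = 0) -> (x <= Y)%MS.
Proof.
move=> h; rewrite submxE; apply/eqP/rowP => j.
have E z : dotv (col j (cokermx Y))^T z = (z *m cokermx Y) 0 j.
  by rewrite mxE; apply: eq_bigr => i _; rewrite !mxE mulrC.
rewrite -E mxE h // => i; rewrite E.
by rewrite -row_mul mulmx_coker !mxE.
Qed.

Definition convex C := forall x y t,
  C x -> C y -> 0 <= t -> t <= 1 -> C (t *: x + (1 - t) *: y).

Lemma conv_convex S : convex (conv S).
Proof.
move=> x y t [w [w0 [w1 ->]]] [w' [w'0 [w'1 ->]]] t0 t1.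
exists (fun i => t * w i + (1 - t) * w' i); split.
  by move=> i; rewrite addr_ge0 ?mulr_ge0 ?subr_ge0.
split; first by rewrite big_split /= -!mulr_sumr w1 w'1; lra.
rewrite !scaler_sumr -big_split /=; apply: eq_bigr => i _.
by rewrite [RHS]scalerDl !scalerA.
Qed.

Lemma conv_mem S s : s \in S -> conv S s.
Proof.
rewrite -index_mem => lt_i; pose j := Ordinal lt_i.
exists (fun i => (i == j)%:R); split; first by move=> i; case: (i == j).
split; first by rewrite (bigD1 j) //= eqxx big1 ?addr0 // => i /negPf->.
rewrite (bigD1 j) //= eqxx scale1r big1 ?addr0 ?nth_index -?index_mem //.
by move=> i /negPf->; rewrite scale0r.
Qed.

(** Peeling off one generator gives induction on the list. The remaining weights are rescaled by
    [(1 - t)^-1], so weight 1 on [s] is a separate case. *)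
Lemma conv_cons s S x : conv (s :: S) x ->
  x = s \/ exists t y, [/\ 0 <= t, t <= 1, conv S y & x = t *: s + (1 - t) *: y].
Proof.
case=> w [w0 []]; rewrite !big_ord_recl /= => w1 ->.
set t := w ord0 in w1 *.
have t0 : 0 <= t by apply: w0.
have sum0 : 0 <= \sum_(i < size S) w (lift ord0 i) by apply: sumr_ge0.
have [t1|t1] := eqVneq t 1.
  left; rewrite t1 scale1r big1 ?addr0 // => i _.
  have /psumr_eq0P -> : \sum_(i < size S) w (lift ord0 i) = 0 by lra.
  - by rewrite scale0r.
  - by move=> j _; apply: w0.
  - by [].
right; exists t, (\sum_(i < size S) ((1 - t)^-1 * w (lift ord0 i)) *: nth 0 S i).
have t1' : 1 - t != 0 by rewrite subr_eq0 eq_sym.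
have tle : t <= 1 by lra.
split=> //.
  exists (fun i => (1 - t)^-1 * w (lift ord0 i)); split.
    by move=> i; rewrite mulr_ge0 ?invr_ge0 ?subr_ge0.
  split=> //; rewrite -mulr_sumr -{1}w1 addrC addKr mulVf //.
  by rewrite -w1 addrC addKr in t1'.
rewrite scaler_sumr; congr (_ + _); apply: eq_bigr => i _.
by rewrite scalerA mulrA mulfV // mul1r.
Qed.

Lemma conv_nil x : ~ conv [::] x.
Proof. by case=> w [_ [/esym/eqP]]; rewrite big_ord0 oner_eq0. Qed.

Lemma conv_ind C S : convex C -> (forall s, s \in S -> C s) ->
  subsetP (conv S) C.
Proof.
move=> cC; elim: S => [|s S IH] h x; first by move/conv_nil.
move/conv_cons => [->|[t [y [t0 t1 Sy ->]]]]; first by apply: h; apply: mem_head.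
apply: cC => //; first by apply: h; apply: mem_head.
by apply: IH Sy => z zS; apply: h; rewrite inE zS orbT.
Qed.

Lemma conv_sub S T : {subset S <= T} -> subsetP (conv S) (conv T).
Proof.
by move=> sST; apply: conv_ind (@conv_convex T) _ => s /sST; apply: conv_mem.
Qed.

Lemma conv_le S a (b : R) :
  (forall s, s \in S -> dotv a s <= b) -> forall x, conv S x -> dotv a x <= b.
Proof.
apply: conv_ind => x y t ax ay t0 t1; rewrite !dotvE.
have := ler_wpM2l t0 ax; have : 0 <= 1 - t by lra.
by move/ler_wpM2l => /(_ _ _ ay); lra.
Qed.

(** An average of values at most [b] equals [b] only if every generator of positive weight attains
    [b]. *)
Lemma conv_filter S a (b : R) x :
  (forall s, s \in S -> dotv a s <= b) -> conv S x -> dotv a x = b ->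
  conv [seq s <- S | dotv a s == b] x.
Proof.
elim: S x => [|s S IH] x h; first by move/conv_nil.
have hs : dotv a s <= b by apply: h; apply: mem_head.
have hS z : z \in S -> dotv a z <= b by move=> zS; apply: h; rewrite inE zS orbT.
have subS : {subset [seq z <- S | dotv a z == b] <= [seq z <- s :: S | dotv a z == b]}.
  by move=> z; rewrite !mem_filter inE => /andP[-> ->]; rewrite orbT.
move/conv_cons => [-> e|[t [y [t0 t1 Sy ->]]]].
  by apply: conv_mem; rewrite mem_filter e eqxx mem_head.
have ay := conv_le hS Sy; rewrite !dotvE => e.
have [t00|tn0] := eqVneq t 0.
  rewrite t00 scale0r add0r subr0 scale1r; apply: (conv_sub subS).
  by apply: IH => //; move: e; rewrite t00; lra.
have es : dotv a s = b.
  apply/eqP; rewrite eq_le hs /= leNgt; apply/negP => lt_s.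
  have tp : 0 < t by rewrite lt_neqAle eq_sym tn0.
  have : 0 <= 1 - t by lra.
  move/ler_wpM2l => /(_ _ _ ay); move: lt_s; rewrite -(ltr_pM2l tp).
  by move: e; lra.
have sF : s \in [seq z <- s :: S | dotv a z == b].
  by rewrite mem_filter es eqxx mem_head.
have [t11|tn1] := eqVneq t 1.
  by rewrite t11 subrr scale0r addr0 scale1r; apply: conv_mem.
apply: conv_convex => //; first exact: conv_mem.
apply: (conv_sub subS); apply: IH => //.
have t1n : 1 - t != 0 by rewrite subr_eq0 eq_sym.
by apply: (mulfI t1n); move: e; rewrite es; lra.
Qed.

Lemma conv_seg u v x : conv [:: u; v] x <->
  exists t, [/\ 0 <= t, t <= 1 & x = u + t *: (v - u)].
Proof.
split=> [|[t [t0 t1 ->]]].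
  case/conv_cons => [->|[t [y [t0 t1 /conv_cons[->|[? [? [_ _ /conv_nil[]]]]] ->]]]].
    by exists 0; split; rewrite ?scale0r ?addr0 ?ler01.
  exists (1 - t); split; [lra | lra |].
    by rewrite scalerBr addrCA [LHS]addrC; congr (_ + _); rewrite scalerBl scale1r subKr.
have -> : u + t *: (v - u) = t *: v + (1 - t) *: u.
  by rewrite scalerBr scalerBl scale1r addrCA.
by apply: conv_convex => //; apply: conv_mem; rewrite !inE eqxx ?orbT.
Qed.

Lemma isFace_ext P P' F F' :
  seteq P P' -> seteq F F' -> isFace P F -> isFace P' F'.
Proof.
move=> eP eF [a [b [h1 h2]]]; exists a, b; split; first by move=> x /eP; apply: h1.
by move=> x; split=> [/eF/h2 [/eP]|[/eP ? ?]] //; apply/eF/h2.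
Qed.

Lemma face_subset P F : isFace P F -> subsetP F P.
Proof. by case=> a [b [_ h]] x /h[]. Qed.

Lemma face_self P : isFace P P.
Proof.
have z x : dotv 0 x = 0 by rewrite dotvC dotv0r.
by exists 0, 0; split=> x; rewrite z //; split=> // -[].
Qed.

Lemma face_sub_face P F G : isFace P G -> subsetP G F -> subsetP F P -> isFace F G.
Proof.
move=> [a [b [h1 h2]]] GF FP; exists a, b; split; first by move=> x /FP/h1.
by move=> x; split=> [Gx|[/FP ? ?]]; [split; [apply: GF | case/h2: Gx] | apply/h2].
Qed.

Lemma face_inter P B G : isFace P B -> isFace P G -> isFace G (inter G B).
Proof.
move=> [a [b [h1 h2]]] /face_subset GP; exists a, b; split; first by move=> x /GP/h1.
move=> x; split=> [[Gx /h2[]]|[Gx e]] //; split=> //; apply/h2; split=> //.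
exact: GP.
Qed.

(** Passing to a face is filtering the generators, which allows induction on their number. The
    boolean [p] makes membership of a generator in [F] decidable. *)
Lemma face_conv P S F : seteq P (conv S) -> isFace P F ->
  exists2 p : pred V, seteq F (conv (filter p S)) &
    forall s, s \in S -> p s <-> F s.
Proof.
move=> eP [a [b [h1 h2]]].
have hS s : s \in S -> dotv a s <= b by move=> /conv_mem/eP/h1.
exists (fun s => dotv a s == b).
  move=> x; split=> [/h2[/eP Sx e]|Fx]; first exact: conv_filter.
  have Sx : conv S x by apply: conv_sub Fx; apply: mem_subseq; apply: filter_subseq.
  apply/h2; split; first exact/eP.
  apply/eqP; rewrite eq_le (conv_le hS Sx) /= -lerN2 -dotvNl.
  apply: (conv_le _ Fx) => s; rewrite mem_filter dotvNl => /andP[/eqP-> _]; exact: lexx.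
move=> s sS; split=> [/eqP e|/h2[_ ->]] //; apply/h2; split=> //.
exact/eP/conv_mem.
Qed.

Lemma face_polytope P F : polytope P -> isFace P F -> polytope F.
Proof.
by move=> [S eP] /(face_conv eP)[p eF _]; exists (filter p S).
Qed.

Lemma face_convex P F : polytope P -> isFace P F -> convex F.
Proof.
move=> pP /(face_polytope pP)[S e] x y t /e Sx /e Sy t0 t1.
exact/e/conv_convex.
Qed.

Lemma conv_le_rel P S v a : seteq P (conv S) ->
  (forall s, s \in S -> dotv a (s - v) <= 0) -> forall x, P x -> dotv a (x - v) <= 0.
Proof.
move=> eP h x /eP Sx; rewrite dotvDr dotvNr subr_le0; apply: (conv_le _ Sx) => s /h.
by rewrite dotvDr dotvNr subr_le0.
Qed.

Lemma face_rel P S v a : seteq P (conv S) ->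
  (forall s, s \in S -> dotv a (s - v) <= 0) ->
  isFace P (fun x => P x /\ dotv a (x - v) = 0).
Proof.
move=> eP h; exists a, (dotv a v); split.
  by move=> x /(conv_le_rel eP h); rewrite dotvDr dotvNr subr_le0.
move=> x; rewrite dotvDr dotvNr; split=> -[Px /eqP]; last first.
  by move=> /eqP->; rewrite subrr.
by rewrite subr_eq0 => /eqP.
Qed.

(* If [a <= b] supports F and [c <= e] supports G in F, then
   [c + K a <= e + K b] supports G in P for K large. *)
Lemma face_trans P F G : polytope P -> isFace P F -> isFace F G -> isFace P G.
Proof.
move=> [S eP] [a [b [h1 h2]]] [c [e [k1 k2]]].
(* For a generator off F, its own summand plus 1 already outweighs [dotv c s - e]; for one in F the
   denominator is 0 and the summand is 0. *)
pose K := \sum_(s <- S) `|dotv c s - e| / (b - dotv a s) + 1.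
have hS s : s \in S -> dotv a s <= b by move=> /conv_mem/eP/h1.
have neg s : s \in S -> dotv a s < b -> dotv c s - e - K * (b - dotv a s) < 0.
  move=> sS lt; have bs : 0 < b - dotv a s by lra.
  have : `|dotv c s - e| / (b - dotv a s) + 1 <= K.
    rewrite lerD2r (big_rem s) //= lerDl big_seq_cond; apply: sumr_ge0 => z.
    rewrite andbT => /mem_rem zS; rewrite divr_ge0 // subr_ge0; exact: hS.
  rewrite -(ler_pM2r bs) mulrDl divfK ?gt_eqF // mul1r.
  have := ler_norm (dotv c s - e); lra.
have le0 s : s \in S -> dotv (c + K *: a) s <= e + K * b.
  move=> sS; have := hS s sS; rewrite le_eqVlt => /orP[/eqP es|/(neg s sS)].
    have /k1 : F s by apply/h2; split=> //; apply/eP/conv_mem.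
    by rewrite !dotvE es lerD2r.
  by rewrite !dotvE; lra.
exists (c + K *: a), (e + K * b); split; first by move=> x /eP; apply: conv_le.
move=> x; split=> [Gx|[Px ex]].
  by case/k2: Gx => /h2[Px ax] cx; split=> //; rewrite !dotvE ax cx.
have Fx := conv_filter le0 (proj1 (eP x) Px) ex.
have in_F s : s \in [seq s <- S | dotv (c + K *: a) s == e + K * b] ->
    s \in S /\ dotv a s = b.
  rewrite mem_filter => /andP[/eqP es sS]; split=> //.
  apply/eqP; rewrite eq_le hS // leNgt; apply/negP => /(neg s sS).
  by move: es; rewrite !dotvE; lra.
have ax : dotv a x = b.
  apply/eqP; rewrite eq_le h1 //= -lerN2 -dotvNl.
  by apply: (conv_le _ Fx) => s /in_F[_ <-]; rewrite dotvNl.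
apply/k2; split; first exact/h2.
by move: ex; rewrite !dotvE ax; lra.
Qed.

Lemma vertex_mem P v : isVertex P v -> P v.
Proof. by move=> /face_subset; apply. Qed.

Lemma vertex_strict P v : isVertex P v ->
  exists a, forall x, P x -> x != v -> dotv a (x - v) < 0.
Proof.
case=> a [b [h1 h2]]; exists a => x Px xv.
have [_ av] := proj1 (h2 v) erefl.
rewrite dotvDr dotvNr av subr_lt0 lt_neqAle h1 // andbT.
by apply: contraNneq xv => e; apply/eqP/h2.
Qed.

Lemma vertex_in_gen P S v : seteq P (conv S) -> isVertex P v -> v \in S.
Proof.
move=> eP vV; have [p ev ps] := face_conv eP vV.
have [s] : exists s, s \in filter p S.
  have := proj1 (ev v) erefl; case: filter => [/conv_nil//|s ? _].
  by exists s; rewrite mem_head.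
by rewrite mem_filter => /andP[/[swap] sS /ps - /(_ sS) <-].
Qed.

Lemma conv_strict S v a x :
  (forall s, s \in S -> s != v -> dotv a (s - v) < 0) ->
  conv S x -> 0 <= dotv a (x - v) -> x = v.
Proof.
move=> h Sx; rewrite dotvDr dotvNr subr_ge0 => ge.
have le1 s : s \in S -> dotv a s <= dotv a v.
  have [-> //|sv sS] := eqVneq s v.
  by have := h s sS sv; rewrite dotvDr dotvNr subr_lt0 => /ltW.
have ex : dotv a x = dotv a v by apply/eqP; rewrite eq_le ge (conv_le le1 Sx).
apply: (@conv_ind (fun z => z = v) _ _ _ _ (conv_filter le1 Sx ex)).
  by move=> y z t -> -> _ _; rewrite -scalerDl addrC subrK scale1r.
move=> s; rewrite mem_filter => /andP[/eqP es sS].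
apply/eqP; apply: contraT => /(h s sS).
by rewrite dotvDr dotvNr es subrr ltxx.
Qed.

Lemma vertexI P S v a : seteq P (conv S) -> v \in S ->
  (forall s, s \in S -> s != v -> dotv a (s - v) < 0) -> isVertex P v.
Proof.
move=> eP vS h.
have le0 s : s \in S -> dotv a (s - v) <= 0.
  by move=> sS; have [->|/h/ltW->] := eqVneq s v; rewrite ?subrr ?dotv0r.
apply: isFace_ext (face_rel eP le0) => // x; split=> [[/eP Px e]|->]; last first.
  by rewrite subrr dotv0r; split=> //; apply/eP/conv_mem.
by apply: (conv_strict h Px); rewrite e.
Qed.

Lemma face_vertex P F v : polytope P -> isFace P F -> isVertex F v -> isVertex P v.
Proof. exact: face_trans. Qed.

Lemma vertex_face P F v : isVertex P v -> isFace P F -> F v -> isVertex F v.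
Proof.
move=> vP FP Fv; apply: (face_sub_face vP); first by move=> x ->.
exact: face_subset.
Qed.

(** Induction on the number of generators. For generators [s != s'] the functional [s' - s] is not
    constant on them, so the face where it is largest has fewer generators; a vertex of that face is
    one of P. *)
Lemma vertex_exists P : polytope P -> nonempty P -> exists v, isVertex P v.
Proof.
case=> S; have [m] := ubnP (size S); elim: m => // m IH in P S * => /ltnSE Sm eP.
case=> x /eP Sx; case: S => [|s S] in eP Sm Sx *; first by case: (conv_nil Sx).
have [e|] := boolP (all (pred1 s) (s :: S)).
  exists s; apply: (vertexI (a := 0) eP); first exact: mem_head.
  by move=> z /(allP e)/eqP->; rewrite eqxx.
case/allPn => s' s'S /= ns; have [t tS tP] := seq_argmin (dotv (s - s')) s'S.
have le0 z : z \in s :: S -> dotv (s' - s) (z - t) <= 0.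
  by move=> /tP; rewrite !dotvE; lra.
have FP := face_rel eP le0.
have [p eF pF] := face_conv eP FP.
have [||v vF] := IH _ (filter p (s :: S)) _ eF.
- rewrite ltnNge; apply/negP => /(leq_trans Sm).
  rewrite size_filter leqNgt ltn_neqAle count_size andbT -all_count negbK.
  move/allP => ap; have on z : z \in s :: S -> dotv (s' - s) (z - t) = 0.
    by move=> zS; case: (proj1 (pF z zS) (ap z zS)).
  have := on _ (mem_head _ _); have := on _ s'S.
  have : 0 < dotv (s - s') (s - s') by apply: dotv_gt0; rewrite subr_eq0 eq_sym.
  by rewrite !dotvE; lra.
- by exists t; split; [apply/eP/conv_mem | rewrite subrr dotv0r].
by exists v; apply: face_vertex FP vF => //; exists (s :: S).
Qed.

Lemma vertex_max P g : polytope P -> nonempty P ->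
  exists2 v, isVertex P v & forall x, P x -> dotv g x <= dotv g v.
Proof.
move=> pP; case: (pP) => S eP [x /eP Sx].
have [s sS] : exists s, s \in S.
  by case: S Sx {eP} => [/conv_nil//|s ? _]; exists s; apply: mem_head.
have [t tS tP] := seq_argmin (dotv (- g)) sS.
have le0 z : z \in S -> dotv g (z - t) <= 0 by move=> /tP; rewrite !dotvE; lra.
have FP := face_rel eP le0.
have [||v vF] := @vertex_exists (fun x => P x /\ dotv g (x - t) = 0).
- exact: face_polytope FP.
- by exists t; split; [apply/eP/conv_mem | rewrite subrr dotv0r].
exists v; first exact: face_vertex vF.
move=> y Py; have := conv_le_rel eP le0 Py.
by have [_] := vertex_mem vF; rewrite !dotvE; lra.
Qed.

End Polytopes.

(** * Dimension, segments as edges, and a first existence result for edges *)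

Section Edges.
Variables (R : realFieldType) (n : nat).
Local Notation V := 'rV[R]_n.
Implicit Types (S T : seq V) (P F G B C : pset R n) (a c g x y v u s : V).

Lemma affdim_ext F F' k : seteq F F' -> affdim F k -> affdim F' k.
Proof.
move=> e [x0 [/e Fx0 [Y [h1 [h2 h3]]]]]; exists x0; split=> //; exists Y.
by split=> [i|]; [apply/e | split=> // x /e/h3].
Qed.

Lemma hasDim_ext F F' d : seteq F F' -> hasDim F d -> hasDim F' d.
Proof.
move=> e [[-> h]|[k [-> h]]]; [left|right].
  by split=> // -[x /e Fx]; apply: h; exists x.
by exists k; split=> //; apply: affdim_ext h.
Qed.

Lemma affdim_le F k k' : affdim F k -> affdim F k' -> (k <= k')%N.
Proof.
move=> [x0 [Fx0 [Y [h1 [/eqP h2 h3]]]]] [x1 [Fx1 [Z [k1 [/eqP k2 k3]]]]].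
rewrite -h2 -k2; apply: mxrankS; apply/row_subP => i.
have := k3 _ (h1 i); rewrite addrAC => hi.
have -> : row i Y = x0 - x1 + row i Y - (x0 - x1) by rewrite addrAC subrr add0r.
by rewrite addmx_sub ?eqmx_opp ?k3.
Qed.

Lemma affdim_inj F k k' : affdim F k -> affdim F k' -> k = k'.
Proof. by move=> h h'; apply/eqP; rewrite eqn_leq !(@affdim_le F). Qed.

Lemma hasDim_inj F d d' : hasDim F d -> hasDim F d' -> d = d'.
Proof.
have ne k : affdim F k -> nonempty F by case=> x [Fx _]; exists x.
case=> [[-> h]|[k [-> h]]] [[-> h']|[k' [-> h']]] //.
- by case: h; apply: ne h'.
- by case: h'; apply: ne h.
- by rewrite (affdim_inj h h').
Qed.

Lemma hasDim_nonempty F d : nonempty F -> hasDim F d ->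
  exists2 k : nat, d = k & affdim F k.
Proof. by move=> ne [[_ /(_ ne)[]]|[k [-> h]]]; exists k. Qed.

(** The basis is extracted from the vectors [s - x0] with [s] a generator, so that [x0] plus a basis
    row is again a point of P. *)
Lemma affdim_exists P : polytope P -> nonempty P -> exists k, affdim P k.
Proof.
case=> S eP [x0 Px0].
pose A := \matrix_(i < size S) (nth 0 S i - x0).
exists (\rank A), x0; split=> //; exists (rowsub (maxrankfun A) A).
split=> [i|]; first rewrite row_rowsub rowK addrC subrK.
  exact/eP/conv_mem/mem_nth.
split; first exact: maxrowsub_free.
move=> x /eP; rewrite eq_maxrowsub.
move: x; apply: (@conv_ind _ _ (fun x => (x - x0 <= A)%MS)) => [x y t hx hy _ _|s sS].
  have -> : t *: x + (1 - t) *: y - x0 = t *: (x - x0) + (1 - t) *: (y - x0).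
    rewrite !scalerBr addrACA -opprD -scalerDl [t + _]addrC subrK scale1r //.
  by rewrite addmx_sub ?scalemx_sub.
have lt_i : (index s S < size S)%N by rewrite index_mem.
by have := row_sub (Ordinal lt_i) A; rewrite rowK /= nth_index.
Qed.

Lemma hasDim_seg v u : v != u -> hasDim (conv [:: v; u]) 1.
Proof.
move=> vu; right; exists 1%N; split=> //; exists v; split.
  by apply: conv_mem; apply: mem_head.
exists (u - v); split=> [i|].
  rewrite row_id (_ : v + (u - v) = u); last by rewrite addrC subrK.
  by apply: conv_mem; rewrite !inE eqxx orbT.
split; first by rewrite /row_free rank_rV subr_eq0 [u == v]eq_sym vu.
by move=> x /conv_seg[t [_ _ ->]]; rewrite addrC addKr scalemx_sub.
Qed.

(** This makes the canopy loop-free: the only direction in a degenerate segment is 0, which is not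
    row free. *)
Lemma seg_not_edge v P : ~ isEdge P (conv [:: v; v]).
Proof.
case=> _ [[]|[k [[<-] [x0 [/conv_seg[t [_ _ ->]] [Y [h1 [h2 _]]]]]]]] //.
have /conv_seg[t' [_ _]] := h1 ord0; rewrite !subrr !scaler0 !addr0 row_id => /eqP.
rewrite -subr_eq0 addrAC subrr add0r => /eqP Y0.
by move: h2; rewrite Y0 /row_free mxrank0.
Qed.

Lemma seg_sym v u : seteq (conv [:: v; u]) (conv [:: u; v]).
Proof. by move=> x; split; apply: conv_sub => z; rewrite !inE orbC. Qed.

Lemma edge_sym P v u : isEdge P (conv [:: v; u]) -> isEdge P (conv [:: u; v]).
Proof.
case=> eF eD; split; [apply: isFace_ext eF | apply: hasDim_ext eD] => //;
exact: seg_sym.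
Qed.

Lemma dim_le1_collinear F d v x y : hasDim F d -> d <= 1 -> F v -> F x -> F y ->
  exists e : V, exists p q, x - v = p *: e /\ y - v = q *: e.
Proof.
move=> dF d1 Fv Fx Fy; have [|k ? [x0 [_ [Y [_ [_ h]]]]]] := hasDim_nonempty _ dF.
  by exists v.
subst d; have k1 : (k <= 1)%N by [].
have sp z : F z -> (z - v <= Y)%MS.
  move=> Fz; have -> : z - v = (z - x0) - (v - x0) by rewrite opprB addrA subrK.
  by rewrite addmx_sub ?eqmx_opp ?h.
case: k k1 Y sp {h dF d1} => [_|[_|//]] Y sp.
  exists 0, 0, 0; rewrite !scale0r.
  have sp0 z : F z -> z - v = 0.
    by move=> /sp/submxP[D ->]; rewrite (flatmx0 Y) mulmx0.
  by rewrite !sp0.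
have sp' z : F z -> exists p, z - v = p *: Y by move/sp/sub_rVP.
by have [p ep] := sp' x Fx; have [q eq] := sp' y Fy; exists Y, p, q.
Qed.

(** Induction on the number of generators. If all lie on one ray from v, then P is the segment to
    the farthest. Otherwise some [c] has a non-constant slope [dotv c (s - v) / dotv g (s - v)], and
    the face of largest slope keeps v and another generator but loses [s1]. *)
Lemma edge_up_of_positive P S v g : seteq P (conv S) -> isVertex P v ->
  (forall s, s \in S -> s != v -> 0 < dotv g (s - v)) ->
  (exists2 s, s \in S & s != v) ->
  exists u, [/\ isVertex P u, isEdge P (conv [:: v; u]) & 0 < dotv g (u - v)].
Proof.
have [m] := ubnP (size S); elim: m => // m IH in P S * => /ltnSE Sm eP vP h [s1 s1S s1v].
have pP : polytope P by exists S.
have g1 := h s1 s1S s1v.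
have [par|] := boolP (all (fun s => dotv g (s1 - v) *: (s - v) ==
                                  dotv g (s - v) *: (s1 - v)) S).
  have [u uS uP] := seq_argmin (dotv (- g)) s1S.
  have gu : 0 < dotv g (u - v) by have := uP _ s1S; move: g1; rewrite !dotvE; lra.
  have uv : u != v by apply: contraTneq gu => ->; rewrite subrr dotv0r ltxx.
  have on_ray s : s \in S -> s - v = (dotv g (s - v) / dotv g (u - v)) *: (u - v).
    move=> sS; apply: (scalerI (lt0r_neq0 g1)); rewrite (eqP (allP par s sS)).
    rewrite scalerA mulrC -scalerA (eqP (allP par u uS)) scalerA divfK //.
    by rewrite gt_eqF.
  have seg s : s \in S -> conv [:: v; u] s.
    move=> sS; apply/conv_seg; exists (dotv g (s - v) / dotv g (u - v)); split.
    - have [->|/(h s sS)/ltW gs] := eqVneq s v; first by rewrite subrr dotv0r mul0r.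
      by rewrite divr_ge0 // ltW.
    - by rewrite ler_pdivrMr // mul1r; have := uP _ sS; rewrite !dotvE; lra.
    - by rewrite -on_ray // addrC subrK.
  exists u; split=> //.
    apply: (vertexI (a := g) eP uS) => s sS su.
    have := uP s sS; rewrite !dotvNl lerN2 dotvDr dotvNr subr_lt0 le_eqVlt.
    case/orP=> // /eqP e; case/negP: su; rewrite -(inj_eq (subIr v)) on_ray //.
    by rewrite !dotvDr e divff ?scale1r // -dotvDr gt_eqF.
  split; last by apply: hasDim_seg; rewrite eq_sym.
  apply: isFace_ext (face_self P) => // x; split=> [/eP|].
    by apply: conv_ind; [apply: conv_convex | apply: seg].
  move=> /conv_sub vux; apply/eP/vux => z.
  by rewrite !inE => /orP[/eqP->|/eqP->] //; apply: vertex_in_gen vP.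
case/allPn => s2 s2S; set z := (X in X == _); set z' := (X in _ == X) => zz'.
have s2v : s2 != v.
  apply: contraNneq zz'; rewrite /z /z' => ->; by rewrite subrr scaler0 dotv0r scale0r.
have g2 := h s2 s2S s2v.
(* Divided by both [g]-values, [cpos] says that the slope of [s2] exceeds that of [s1]. *)
have [c cpos] : exists c, 0 < dotv c z - dotv c z'.
  by exists (z - z'); rewrite -dotvNr -dotvDr; apply: dotv_gt0; rewrite subr_eq0.
have [t] := @seq_argmin _ _ (fun s => - (dotv c (s - v) / dotv g (s - v)))
   [seq s <- S | s != v] s1 ltac:(by rewrite mem_filter s1v).
rewrite mem_filter => /andP[tv tS] tP; have gt := h t tS tv.
pose r := dotv c (t - v) / dotv g (t - v).
have le0 s : s \in S -> dotv (c - r *: g) (s - v) <= 0.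
  move=> sS; have [->|sv] := eqVneq s v; first by rewrite subrr dotv0r.
  have := tP s; rewrite mem_filter sv sS lerN2 => /(_ isT).
  by rewrite ler_pdivrMr ?h // -/r dotvDl dotvNl dotvZl subr_le0.
have FP := face_rel eP le0; have [p eF pF] := face_conv eP FP.
have [||||u [uF euF gu]] := IH _ (filter p S) _ eF.
- apply: leq_trans Sm; rewrite size_filter ltn_neqAle count_size andbT -all_count.
  apply/negP => /allP/(_ s1 s1S)/(pF s1 s1S)[_].
  have := le0 s2 s2S; rewrite !dotvDl !dotvNl !dotvZl; move: cpos.
  rewrite /z /z' !dotvZr => cp le2 e1.
  have := ler_wpM2l (ltW g1) le2; rewrite mulr0.
  have : dotv g (s2 - v) * (dotv c (s1 - v) - r * dotv g (s1 - v)) = 0.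
    by rewrite e1 mulr0.
  by lra.
- by apply: (vertex_face vP FP); split; [apply: vertex_mem | rewrite subrr dotv0r].
- by move=> s; rewrite mem_filter => /andP[_]; apply: h.
- exists t; rewrite ?mem_filter ?tS ?andbT //; apply/pF => //; split; first exact/eP/conv_mem.
  by rewrite !dotvDl dotvNl dotvZl divfK ?subrr // gt_eqF.
exists u; split=> //; first exact: face_vertex uF.
by case: euF => euF ?; split=> //; apply: face_trans euF.
Qed.

End Edges.

(** * Edges going up at a vertex: existence and uniqueness *)

Section Treetopes.
Variables (R : realFieldType) (n : nat).
Local Notation V := 'rV[R]_n.
Implicit Types (S T : seq V) (P F G B C : pset R n) (a c g x y v u s : V).

(** The functional [a] supports the hull at v, and on its face every generator other than v rises
    strictly along [g]. If [g] does not rise from v on B, this face meets B in at most v, and the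
    treetope condition applies to it. *)
Definition adapted S v g a :=
  (forall s, s \in S -> dotv a (s - v) <= 0) /\
  (forall s, s \in S -> s != v -> dotv g (s - v) <= 0 -> dotv a (s - v) < 0).

(* Tilting [a] towards [g] until it first touches S. *)
Lemma adapted_exists S v g a :
  (forall s, s \in S -> s != v -> dotv g (s - v) <= 0 ->
     dotv a (s - v) < 0 /\ (dotv g (s - v) = 0 \/
       forall t, t \in S -> dotv a (t - v) <= 0)) ->
  (exists2 s, s \in S & 0 < dotv g (s - v)) ->
  exists r, adapted S v g (a + r *: g) /\
    exists s, [/\ s \in S, 0 < dotv g (s - v) & dotv (a + r *: g) (s - v) = 0].
Proof.
move=> h [s1 s1S g1].
have [t] := @seq_argmin _ _ (fun s => - dotv a (s - v) / dotv g (s - v))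
  [seq s <- S | 0 < dotv g (s - v)] s1 ltac:(by rewrite mem_filter g1).
rewrite mem_filter => /andP[gt tS] tP.
pose r := - dotv a (t - v) / dotv g (t - v); exists r.
have up s : s \in S -> 0 < dotv g (s - v) -> dotv (a + r *: g) (s - v) <= 0.
  move=> sS gs; have := tP s; rewrite mem_filter gs sS => /(_ isT).
  by rewrite ler_pdivlMr // -/r dotvDl dotvZl; lra.
(* Either [g] vanishes at [s - v] and the tilt changes nothing, or [a] is nonpositive throughout,
   which forces [r >= 0], and the tilt cannot raise the value. *)
have dn s : s \in S -> s != v -> dotv g (s - v) <= 0 -> dotv (a + r *: g) (s - v) < 0.
  move=> sS sv gs; have [alt [e|al]] := h s sS sv gs; rewrite dotvDl dotvZl.
    by rewrite e mulr0 addr0.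
  have r0 : 0 <= r by rewrite divr_ge0 ?oppr_ge0 ?al ?ltW.
  by have := mulr_ge0_le0 r0 gs; lra.
split; last by exists t; split=> //; rewrite dotvDl dotvZl divfK ?subrr ?gt_eqF // addrN.
split=> // s sS; have [->|sv] := eqVneq s v; first by rewrite subrr dotv0r.
by have [/(dn s sS sv)/ltW|/(up s sS)] := leP (dotv g (s - v)) 0.
Qed.

(** The simplex step. A functional strictly maximal at v is tilted towards [g] until its face gains
    a generator; on that face all other generators rise, so [edge_up_of_positive] applies, and an
    edge of a face is an edge of P. *)
Lemma edge_up P v x g : polytope P -> isVertex P v -> P x -> 0 < dotv g (x - v) ->
  exists u, [/\ isVertex P u, isEdge P (conv [:: v; u]) & 0 < dotv g (u - v)].
Proof.
move=> pP vP; case: (pP) => S eP Px gx.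
have [a0 a0P] := vertex_strict vP.
have ltS s : s \in S -> s != v -> dotv a0 (s - v) < 0.
  by move=> sS; apply: a0P; apply/eP/conv_mem.
have leS s : s \in S -> dotv a0 (s - v) <= 0.
  by move=> sS; have [->|/ltS/ltW->] := eqVneq s v; rewrite ?subrr ?dotv0r.
have [||r [[le0 lt0] [t [tS gt et]]]] := @adapted_exists S v g a0.
- by move=> s sS sv _; split; [apply: ltS | right].
- apply: NNPP => h; have : dotv g (x - v) <= 0.
    apply: (conv_le_rel eP _ Px) => s sS; rewrite leNgt; apply/negP => gs.
    by apply: h; exists s.
  by rewrite leNgt gx.
have FP := face_rel eP le0; have [p eF pF] := face_conv eP FP.
have [|s|| u [uF [euF ?] gu]] := edge_up_of_positive (g := g) eF (v := v).
- by apply: (vertex_face vP FP); split; [apply: vertex_mem | rewrite subrr dotv0r].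
- rewrite mem_filter => /andP[ps sS] sv; rewrite ltNge; apply/negP => /(lt0 s sS sv).
  by have /(pF s sS)[_ ->] := ps; rewrite ltxx.
- exists t; first by rewrite mem_filter tS andbT; apply/pF => //; split=> //; apply/eP/conv_mem.
  by apply: contraTneq gt => ->; rewrite subrr dotv0r ltxx.
exists u; split=> //; first exact: face_vertex uF.
by split=> //; apply: face_trans euF.
Qed.

(* Asks only that B be a proper face: that it is a facet follows, see [affdim_succ]. *)
Definition pretreetope P B := polytope P /\ isFace P B /\ (exists x, P x /\ ~ B x) /\
  forall F, isFace P F -> atMostOnePoint (inter F B) -> exists d, hasDim F d /\ d <= 1.

(** The face of an adapted functional meets B in at most v, so it has dimension at most 1 and [s],
    [s'] are collinear with v. Cross-multiplication by the [g]-values states this without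
    division. *)
Lemma adapted_ray P B S v g a s s' :
  pretreetope P B -> seteq P (conv S) -> P v -> (forall b, B b -> dotv g (b - v) <= 0) ->
  adapted S v g a -> s \in S -> s' \in S ->
  dotv a (s - v) = 0 -> dotv a (s' - v) = 0 ->
  dotv g (s' - v) *: (s - v) = dotv g (s - v) *: (s' - v).
Proof.
move=> [_ [_ [_ thin]]] eP Pv gB [le0 lt0] sS s'S es es'.
have FP := face_rel eP le0; have [p eF pF] := face_conv eP FP.
have memP z : z \in S -> P z by move=> zS; apply/eP/conv_mem.
have only_v x : P x /\ dotv a (x - v) = 0 -> B x -> x = v.
  move=> /eF Fx /gB gx; apply: (conv_strict (a := - g) _ Fx).
    move=> z; rewrite mem_filter => /andP[pz zS] zv; rewrite dotvNl oppr_lt0 ltNge.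
    by apply/negP => /(lt0 z zS zv); have /(pF z zS)[_ ->] := pz; rewrite ltxx.
  by rewrite dotvNl oppr_ge0.
have [|d [dF d1]] := thin _ FP.
  by move=> x y [Fx /(only_v x Fx)->] [Fy /(only_v y Fy)->].
have [||| e [k [k' [-> ->]]]] := dim_le1_collinear (v := v) (x := s) (y := s') dF d1.
- by rewrite subrr dotv0r.
- by split=> //; apply: memP.
- by split=> //; apply: memP.
by rewrite !dotvZr !scalerA; congr (_ *: _); rewrite mulrAC [k' * k]mulrC mulrAC.
Qed.

(* If the rays differ, some [a1 + t a2 + r g] is adapted and vanishes on [p1]
   and on a further point off the ray of [p1]. *)
Lemma adapted_same_ray P B S v g a1 a2 p1 p2 :
  pretreetope P B -> seteq P (conv S) -> P v -> (forall b, B b -> dotv g (b - v) <= 0) ->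
  adapted S v g a1 -> adapted S v g a2 -> p1 \in S -> p2 \in S ->
  p1 != v -> p2 != v -> dotv a1 (p1 - v) = 0 -> dotv a2 (p2 - v) = 0 ->
  dotv g (p2 - v) *: (p1 - v) = dotv g (p1 - v) *: (p2 - v).
Proof.
move=> pt eP Pv gB ad1 ad2 p1S p2S p1v p2v e1 e2.
have ray := adapted_ray pt eP Pv gB.
have gpos a p : adapted S v g a -> p \in S -> p != v -> dotv a (p - v) = 0 ->
    0 < dotv g (p - v).
  move=> [_ lt] pS pv e; rewrite ltNge; apply/negP => /(lt p pS pv).
  by rewrite e ltxx.
have g1 := gpos _ _ ad1 p1S p1v e1; have g2 := gpos _ _ ad2 p2S p2v e2.
have [e|ne1] := eqVneq (dotv a2 (p1 - v)) 0; first exact: ray ad2 _ _ _ _.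
have [e|ne2] := eqVneq (dotv a1 (p2 - v)) 0; first exact: ray ad1 _ _ _ _.
have lt1 : dotv a2 (p1 - v) < 0 by rewrite lt_neqAle ne1; apply: ad2.1.
have lt2 : dotv a1 (p2 - v) < 0 by rewrite lt_neqAle ne2; apply: ad1.1.
(* [al a s] is the multiple of [g] that must be added to [a] for the sum to vanish at [s - v]. *)
pose al a s := - dotv a (s - v) / dotv g (s - v).
have alE a s : 0 < dotv g (s - v) -> dotv a (s - v) = - al a s * dotv g (s - v).
  by move=> gs; rewrite mulNr divfK ?opprK // gt_eqF.
have al_ge0 a s : adapted S v g a -> s \in S -> 0 < dotv g (s - v) -> 0 <= al a s.
  by move=> ad sS gs; apply: divr_ge0; [rewrite oppr_ge0; apply: ad.1 | apply: ltW].
(* In the family [a1 + q *: a2 + (q * al a2 p1) *: g] the last coefficient keeps the value at [p1]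
   equal to 0. As q grows from 0, a candidate [s] reaches value 0 at [q = tau s]; the least such q
   is used. *)
pose cand s := [&& 0 < dotv g (s - v), 0 < al a1 s & al a2 s < al a2 p1].
pose tau s := al a1 s / (al a2 p1 - al a2 s).
have [t] := @seq_argmin _ _ tau (filter cand S) p2 ltac:(rewrite mem_filter p2S andbT;
  by rewrite /cand g2 /al e2 oppr0 mul0r !divr_gt0 ?oppr_gt0).
rewrite mem_filter => /andP[/and3P[gt at1 at2] tS] tP.
have tp : 0 < tau t by rewrite divr_gt0 // subr_gt0.
have a2p1 : 0 < al a2 p1 by rewrite divr_gt0 ?oppr_gt0.
pose a := a1 + tau t *: a2 + (tau t * al a2 p1) *: g.
have aE s : dotv a (s - v) =
    dotv a1 (s - v) + tau t * dotv a2 (s - v) + tau t * al a2 p1 * dotv g (s - v).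
  by rewrite !dotvDl !dotvZl.
have aE' s : 0 < dotv g (s - v) -> dotv a (s - v) =
    - (al a1 s - tau t * (al a2 p1 - al a2 s)) * dotv g (s - v).
  by move=> gs; rewrite aE (alE a1) // (alE a2) //; lra.
have ad : adapted S v g a.
  split=> [s sS|s sS sv gs]; last first.
    have := ad1.2 s sS sv gs.
    have : tau t * dotv a2 (s - v) < 0.
      by rewrite pmulr_rlt0 //; apply: ad2.2.
    have := mulr_ge0_le0 (ltW (mulr_gt0 tp a2p1)) gs; rewrite aE; lra.
  have [gs|gs] := leP (dotv g (s - v)) 0.
    rewrite aE; have := ad1.1 s sS; have := mulr_ge0_le0 (ltW tp) (ad2.1 s sS).
    have := mulr_ge0_le0 (ltW (mulr_gt0 tp a2p1)) gs; lra.
  rewrite aE' // mulNr oppr_le0 pmulr_lge0 // subr_ge0.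
  have a1s := al_ge0 _ _ ad1 sS gs.
  have [ge|lt] := leP (al a2 p1) (al a2 s).
    apply: le_trans a1s; rewrite pmulr_rle0 //; lra.
  (* A generator on the face of [a1] is on the ray of [p1], hence has the same [al a2], against
     [lt]. *)
  have [z|nz] := eqVneq (al a1 s) 0.
    have /(ray _ _ _ ad1 p1S sS e1) : dotv a1 (s - v) = 0.
      by rewrite alE // z oppr0 mul0r.
    move/(congr1 (dotv a2)); rewrite !dotvZr (alE a2 s) // (alE a2 p1) // => e.
    suff : al a2 s = al a2 p1 by lra.
    apply: (mulfI (lt0r_neq0 gs)); apply: (mulfI (lt0r_neq0 g1)); lra.
  rewrite -ler_pdivlMr ?subr_gt0 //; apply: tP.
  by rewrite mem_filter sS /cand gs lt lt_neqAle eq_sym nz a1s.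
have ap1 : dotv a (p1 - v) = 0.
  by rewrite aE' // /al e1 oppr0 mul0r subrr mulr0 subrr oppr0 mul0r.
have at' : dotv a (t - v) = 0.
  by rewrite aE' // divfK ?subrr ?oppr0 ?mul0r // gt_eqF // subr_gt0.
(* Now [t] is on the ray of [p1], so [a1] vanishes there too, against [0 < al a1 t]. *)
have /(congr1 (dotv a1)) := ray _ _ _ ad p1S tS ap1 at'.
rewrite !dotvZr e1 mulr0 => /esym/eqP; rewrite mulf_eq0 gt_eqF //= => /eqP z.
by move: at1; rewrite /al z oppr0 mul0r ltxx.
Qed.

(** If they differed, the nearer vertex would lie strictly between v and the other, against a
    functional strictly maximal at it. *)
Lemma vertex_same_ray P v g u1 u2 : P v -> isVertex P u1 -> isVertex P u2 ->
  0 < dotv g (u1 - v) -> 0 < dotv g (u2 - v) ->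
  dotv g (u2 - v) *: (u1 - v) = dotv g (u1 - v) *: (u2 - v) -> u1 = u2.
Proof.
move=> Pv; wlog le12 : u1 u2 / dotv g (u1 - v) <= dotv g (u2 - v).
  move=> H v1 v2 g1 g2 e; have [le|/ltW le] := leP (dotv g (u1 - v)) (dotv g (u2 - v)).
    exact: H e.
  by apply/esym; apply: H.
move=> v1 v2 g1 g2 e; apply/eqP; apply: contraT; rewrite eq_sym => ne.
have [a aP] := vertex_strict v1.
have lt2 := aP _ (vertex_mem v2) ne.
have ltv : dotv a (v - u1) < 0.
  by apply: aP => //; apply: contraTneq g1 => ->; rewrite subrr dotv0r ltxx.
have := congr1 (dotv a) e; rewrite !dotvZr.
have -> : dotv a (u2 - v) = dotv a (u2 - u1) - dotv a (v - u1) by rewrite !dotvE; lra.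
have -> : dotv a (u1 - v) = - dotv a (v - u1) by rewrite !dotvE; lra.
have : dotv g (u1 - v) * dotv a (u2 - u1) < 0 by rewrite pmulr_rlt0.
have := ler_wnM2r (ltW ltv) le12; lra.
Qed.

(** A generator on the edge is [v + t *: (u - v)], so it rises along [g] as soon as [t] is
    nonzero. *)
Lemma edge_adapted P S v u g : seteq P (conv S) -> isEdge P (conv [:: v; u]) ->
  0 < dotv g (u - v) -> exists a, adapted S v g a /\ dotv a (u - v) = 0.
Proof.
move=> eP [[a [b [h1 h2]]] _] gu.
have [_ av] := proj1 (h2 v) ltac:(by apply: conv_mem; apply: mem_head).
have [_ au] := proj1 (h2 u) ltac:(by apply: conv_mem; rewrite !inE eqxx orbT).
exists a; rewrite dotvDr dotvNr av au subrr; split=> //.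
have le0 s : s \in S -> dotv a (s - v) <= 0.
  by move=> sS; rewrite dotvDr dotvNr av subr_le0; apply/h1/eP/conv_mem.
split=> // s sS sv; apply: contraTT; rewrite -leNgt => ge.
have e0 : dotv a (s - v) = 0 by apply/eqP; rewrite eq_le ge le0.
have : conv [:: v; u] s.
  apply/h2; split; first exact/eP/conv_mem.
  by move: e0; rewrite dotvDr dotvNr av => /eqP; rewrite subr_eq0 => /eqP.
case/conv_seg => t [t0 _ es]; rewrite -ltNge es addrC addKr dotvZr mulr_gt0 //.
rewrite lt_neqAle t0 andbT; apply: contraNneq sv => t00.
by rewrite es -t00 scale0r addr0.
Qed.

Lemma edge_up_unique P B v g u1 u2 : pretreetope P B -> isVertex P v ->
  (forall b, B b -> dotv g (b - v) <= 0) ->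
  isVertex P u1 -> isEdge P (conv [:: v; u1]) -> 0 < dotv g (u1 - v) ->
  isVertex P u2 -> isEdge P (conv [:: v; u2]) -> 0 < dotv g (u2 - v) ->
  u1 = u2.
Proof.
move=> pt vP gB v1 e1 g1 v2 e2 g2; case: (pt) => -[S eP] _.
have [a1 [ad1 z1]] := edge_adapted eP e1 g1.
have [a2 [ad2 z2]] := edge_adapted eP e2 g2.
have ne u : 0 < dotv g (u - v) -> u != v.
  by move=> gu; apply: contraTneq gu => ->; rewrite subrr dotv0r ltxx.
apply: (vertex_same_ray (vertex_mem vP) v1 v2 g1 g2).
by apply: (adapted_same_ray pt eP (vertex_mem vP) gB ad1 ad2); rewrite ?ne //;
  apply: vertex_in_gen eP _.
Qed.

End Treetopes.

(** The number of [r]-successors in S drops along [r]. Transitivity is asked on S only because the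
    ratio order used for the simplex method is shown transitive only at points of P. *)
Lemma seq_strict_order_ind (T : eqType) (S : seq T) (r : rel T) (Q : T -> Prop) :
  irreflexive r ->
  {in S & &, forall y x z, r x y -> r y z -> r x z} ->
  (forall x, x \in S -> (forall y, y \in S -> r x y -> Q y) -> Q x) ->
  forall x, x \in S -> Q x.
Proof.
move=> irr tr step x; have [m] := ubnP (count (r x) S).
elim: m x => // m IH x /ltnSE le xS; apply: step => // y yS rxy; apply: IH => //.
apply: leq_trans le; rewrite -[X in (X < _)%N]addn0 -!sum1_count.
rewrite [X in (_ < X)%N](bigID (r y)) /= -addnS; apply: leq_add.
  rewrite big_seq_cond [X in (_ <= X)%N]big_seq_cond; apply/eq_leq/eq_bigl => z.
  have [zS|//] := boolP (z \in S); have [ryz|] := boolP (r y z) => /=.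
    by rewrite (tr y x z).
  by rewrite andbF.
by rewrite (big_rem y) //= rxy irr.
Qed.

(** * Walks, cycles and bridges in graphs *)

Section Walks.
Variables (R : realFieldType) (n : nat).
Local Notation V := 'rV[R]_n.
Implicit Types (E : prel R n) (x y z u v : V).

Definition reach E x y := exists s, walk E x s /\ last x s = y.

Lemma reach_refl E x : reach E x x.
Proof. by exists [::]. Qed.

Lemma reach_step E x y z : E x y -> reach E y z -> reach E x z.
Proof. by move=> exy [s [w l]]; exists (y :: s). Qed.

Lemma reach_ind E (Q : V -> Prop) z : Q z ->
  (forall x y, E x y -> reach E y z -> Q y -> Q x) -> forall x, reach E x z -> Q x.
Proof.
move=> Qz step x [s]; elim: s x => [|y s IH] x /= [] => [_ ->|] //.
by move=> [exy w] l; apply: (step _ y) => //; [exists s | apply: IH].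
Qed.

Lemma reach_trans E x y z : reach E x y -> reach E y z -> reach E x z.
Proof.
move=> xy yz; elim/reach_ind: {x} _ / xy => // x x' e _; exact: reach_step.
Qed.

Lemma reach_sub E E' x y :
  (forall u v, E u v -> E' u v) -> reach E x y -> reach E' x y.
Proof.
move=> h; elim/reach_ind: {x} _ /; first exact: reach_refl.
by move=> x z /h e _; apply: reach_step.
Qed.

Lemma reach_sym E x y : (forall u v, E u v -> E v u) -> reach E x y -> reach E y x.
Proof.
move=> h; elim/reach_ind: {x} _ /; first exact: reach_refl.
move=> x z /h e _ r; apply: reach_trans r _; exact: reach_step (reach_refl _ _).
Qed.

Lemma walk_nth E x s i : walk E x s -> (i < size s)%N ->
  E (nth x (x :: s) i) (nth x (x :: s) i.+1).
Proof.
elim: s x i => // y s IH x [|i] /= [e w] //; rewrite ltnS => lt.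
by have := IH y i w lt; rewrite !(set_nth_default x y) //= ltnS ltnW.
Qed.

Lemma cycle_two_neighbours E x s v :
  (forall u v, E u v -> E v u) -> uniq (x :: s) -> (2 <= size s)%N ->
  walk E x s -> E (last x s) x -> v \in x :: s ->
  exists u1 u2, [/\ u1 \in x :: s, u2 \in x :: s, u1 != u2, E v u1 & E v u2].
Proof.
move=> sym us ss w e /(nthP x)[i lt_i <-].
have {}w j := walk_nth w (i := j).
pose c j := nth x (x :: s) j.
have inc j : (j < size (x :: s))%N -> c j \in x :: s by apply: mem_nth.
have nec j k : (j < k)%N -> (k < size (x :: s))%N -> c j != c k.
  by move=> jk ks; rewrite /c nth_uniq ?(ltn_trans jk) // ltn_eqF.
have lastE : last x s = c (size s) by rewrite /c -[size s]/((size (x :: s)).-1) nth_last.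
(* The neighbours are the cyclic predecessor and successor: the first entry is preceded by the last,
   and the last is followed by the first. *)
case: i lt_i => [|i] lt_i.
  exists (c 1%N), (c (size s)); split; [by apply: inc; apply: leq_trans ss _| | | |].
  - exact: inc.
  - exact: nec.
  - exact/w/(leq_trans _ ss).
  - by apply: sym; rewrite -lastE.
have [lt|] := ltnP i.+1 (size s).
  exists (c i), (c i.+2); split; rewrite ?inc ?nec //; first exact: ltnW.
    by apply/sym/w; apply: ltnW.
  exact: w.
rewrite leq_eqVlt ltnNge -ltnS lt_i orbF => /eqP si.
exists (c 0%N), (c i); split; rewrite ?inc ?nec //; first exact: ltnW.
- by rewrite si in ss.
- exact: ltnW.
- by rewrite -si -/(c _) -lastE.
- by apply/sym/w; rewrite si.
Qed.

(* A cycle through the edge uv is a path from u to v avoiding it. *)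
Lemma acyclic_bridge E u v : (forall x, ~ E x x) -> (forall x y, E x y -> E y x) ->
  acyclicG E -> E u v ->
  ~ reach (fun x y => E x y /\ ~ (x = u /\ y = v \/ x = v /\ y = u)) u v.
Proof.
move=> irr sym acyc euv; set E' := fun x y => _ => ruv.
have simple x : reach E' x v -> exists s, [/\ uniq (x :: s), walk E' x s & last x s = v].
  elim/reach_ind: {x} _ /; first by exists [::].
  move=> x y exy _ [s [us ws ls]].
  have [xs|xs] := boolP (x \in y :: s); last by exists (y :: s); split=> //=; rewrite xs.
  (* If x recurs on the walk, the part before that occurrence is cut off. *)
  have drops : forall s y, walk E' y s -> x \in y :: s -> uniq (y :: s) ->
      exists s', [/\ uniq (x :: s'), walk E' x s' & last x s' = last y s].
    elim=> [|z t IH] y'; first by rewrite inE => _ /eqP-> _; exists [::].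
    move=> w; have [-> _ ut|ne] := eqVneq x y'; first by exists (z :: t).
    rewrite inE (negPf ne) => xt /=/andP[_ ut]; apply: IH => //; exact: w.2.
  by have [s' [us' ws' ls']] := drops s y ws xs us; exists s'; rewrite ls'.
have [s [us ws ls]] := simple u ruv.
apply: acyc; exists u, s; split=> //; split; last first.
  split; last by rewrite ls; apply: sym.
  have sub : forall s x, walk E' x s -> walk E x s.
    by elim=> // y t IH x [[? _] /IH].
  exact: sub.
(* An empty walk would make uv a loop, and a walk of one step would be the removed edge itself. *)
case: s us ws ls => [|y [|z s]] //= _; first by move=> _ uv; case: (irr u); rewrite {2}uv.
by move=> [[_ h] _] yv; case: h; left.
Qed.

End Walks.

(** * The canopy is a tree *)

Section Canopy.
Variables (R : realFieldType) (n : nat).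
Local Notation V := 'rV[R]_n.
Implicit Types (S T : seq V) (P F G B C : pset R n) (a c g x y v u s : V).

Lemma face_height P B : isFace P B -> exists h (b : R),
  (forall x, P x -> b <= dotv h x) /\ (forall x, P x -> (B x <-> dotv h x = b)).
Proof.
case=> a [b [h1 h2]]; exists (- a), (- b).
split=> [x /h1|x Px]; rewrite dotvNl ?lerN2 //.
by split=> [/h2[_ ->]|/oppr_inj e] //; apply/h2.
Qed.

Lemma height_off P B h (b : R) x : (forall x, P x -> b <= dotv h x) ->
  (forall x, P x -> (B x <-> dotv h x = b)) -> P x -> ~ B x -> b < dotv h x.
Proof.
move=> h1 h2 Px nB; rewrite lt_neqAle h1 // andbT eq_sym.
by apply/eqP => /(h2 x Px).
Qed.

Lemma canopyE_intro P B v u : isVertex P v -> isVertex P u ->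
  isEdge P (conv [:: v; u]) -> ~ B v \/ ~ B u -> canopyE P B v u.
Proof.
move=> vP uP e nB; split=> //; split=> //; split=> // sub.
by case: nB; apply; apply: sub; apply: conv_mem; rewrite !inE eqxx ?orbT.
Qed.

Lemma canopyE_not_in P B v u : polytope P -> isFace P B -> canopyE P B v u ->
  B v -> ~ B u.
Proof.
move=> pP BP [_ [_ [_ sub]]] Bv Bu; apply: sub; apply: conv_ind.
  exact: face_convex BP.
by move=> s; rewrite !inE => /orP[/eqP->|/eqP->].
Qed.

Lemma canopy_graph P B : isGraph (canopyV P) (canopyE P B).
Proof.
split; first by move=> u v [? [? _]].
split=> [u v [? [? [? sub]]]|u [_ [_ [/seg_not_edge]]]] //.
split=> //; split=> //; split; first exact: edge_sym.
by move=> h; apply: sub => x /seg_sym; apply: h.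
Qed.

Lemma canopyE_neq P B v u : canopyE P B v u -> v != u.
Proof. by move=> e; apply/eqP => vu; case: (canopy_graph P B) => _ [_ /(_ v)]; rewrite {2}vu. Qed.

Lemma canopyE_sym P B v u : canopyE P B v u -> canopyE P B u v.
Proof. by have [_ [h _]] := canopy_graph P B; apply: h. Qed.

Lemma canopy_up_unique P B h (b : R) v u1 u2 : pretreetope P B ->
  (forall x, P x -> b <= dotv h x) -> (forall x, P x -> (B x <-> dotv h x = b)) ->
  canopyE P B v u1 -> canopyE P B v u2 ->
  dotv h v <= dotv h u1 -> dotv h v <= dotv h u2 -> u1 = u2.
Proof.
move=> pt hP hB c1 c2; case: (pt) => pP [BP _]; case: (c1) => vP _.
have PV x : isVertex P x -> P x by apply: vertex_mem.
have Pv := PV _ vP; have BsubP := face_subset BP.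
suff [g [gB gup]] : exists g, (forall z, B z -> dotv g (z - v) <= 0) /\
    forall u, canopyE P B v u -> dotv h v <= dotv h u -> 0 < dotv g (u - v).
  move=> le1 le2; case: (c1) => _ [v1 [e1 _]]; case: (c2) => _ [v2 [e2 _]].
  by apply: (edge_up_unique pt vP gB); rewrite ?gup.
have [Bv|nBv] := classic (B v).
  have hv := proj1 (hB v Pv) Bv; exists h; split=> [z Bz|u c _].
    by rewrite dotvDr dotvNr hv (proj1 (hB z _) Bz) ?subrr //; apply: BsubP.
  have nBu := canopyE_not_in pP BP c Bv; have Pu := PV _ c.2.1.
  by rewrite dotvDr dotvNr hv subr_gt0; apply: (height_off hP hB Pu).
(* Off B the heights of v and u may tie. Subtracting [e *: a0], with [a0] strictly maximal at v,
   breaks the tie upwards; [K] bounds [- dotv a0 (x - v)] on P, and [e * K] is less than the height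
   of v, so [g] stays nonpositive on B. *)
have [a0 a0P] := vertex_strict vP; case: (pP) => S eP.
pose K := \sum_(s <- S) `|dotv a0 (s - v)|.
have K0 : 0 <= K by apply: sumr_ge0.
have KP x : P x -> - dotv a0 (x - v) <= K.
  move=> /eP Sx; suff : dotv (- a0) x <= K - dotv a0 v by rewrite !dotvE; lra.
  apply: (conv_le _ Sx) => s sS; have : `|dotv a0 (s - v)| <= K.
    by rewrite /K (big_rem s) //= lerDl; apply: sumr_ge0.
  by have := ler_norm (- dotv a0 (s - v)); rewrite normrN; rewrite !dotvE; lra.
have Hv : 0 < dotv h v - b by rewrite subr_gt0; apply: (height_off hP hB Pv).
pose e := (dotv h v - b) / (K + 1).
have K1 : 0 < K + 1 by lra.
have e0 : 0 < e by rewrite divr_gt0.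
have eK : e * K + e = dotv h v - b by rewrite -{2}[e]mulr1 -mulrDr divfK // gt_eqF.
exists (h - e *: a0); split=> [z Bz|u c le].
  have Pz := BsubP z Bz; have := ler_wpM2l (ltW e0) (KP z Pz).
  by have := proj1 (hB z Pz) Bz; rewrite !dotvE; lra.
have : e * dotv a0 (u - v) < 0.
  have uv : u != v by rewrite eq_sym (canopyE_neq c).
  by rewrite pmulr_rlt0 //; apply: a0P uv; apply: PV c.2.1.
by rewrite !dotvE; lra.
Qed.

Lemma canopy_acyclic P B : pretreetope P B -> acyclicG (canopyE P B).
Proof.
move=> pt [x [s [us [ss [w e]]]]]; case: (pt) => _ [BP _].
have [h [b [h1 h2]]] := face_height BP.
have [v vc vP] := seq_argmin (dotv h) (mem_head x s).
have [|u1 [u2 [c1 c2 ne e1 e2]]] := cycle_two_neighbours _ us ss w e vc.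
  exact: canopyE_sym.
by case/eqP: ne; apply: (canopy_up_unique pt h1 h2 e1 e2); apply: vP.
Qed.

(** The cross-multiplied form admits the denominator 0 of the root. The strict hypotheses force
    [hy], [ny] and [hz] to be positive, so the products can be chained and [hy * ny] cancelled. *)
Lemma ratio_lt_trans (nx ny nz hx hy hz : R) :
  0 <= nx -> 0 <= ny -> 0 <= nz -> 0 <= hx -> 0 <= hy -> 0 <= hz ->
  ny * hx < nx * hy -> nz * hy < ny * hz -> nz * hx < nx * hz.
Proof.
move=> x0 y0 z0 hx0 hy0 hz0 lt1 lt2.
have hyp : 0 < hy.
  rewrite lt_neqAle hy0 andbT; apply/eqP => e; move: lt1; rewrite -e mulr0.
  by rewrite ltNge mulr_ge0.
have nyp : 0 < ny.
  rewrite lt_neqAle y0 andbT; apply/eqP => e; move: lt2; rewrite -e mul0r.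
  by rewrite ltNge mulr_ge0.
have hzp : 0 < hz.
  rewrite lt_neqAle hz0 andbT; apply/eqP => e; move: lt2; rewrite -e mulr0.
  by rewrite ltNge mulr_ge0.
have le : ny * hx * (nz * hy) <= ny * hx * (ny * hz).
  by apply: ler_wpM2l (ltW lt2); apply: mulr_ge0.
have lt : ny * hx * (ny * hz) < nx * hy * (ny * hz).
  by rewrite ltr_pM2r // mulr_gt0.
rewrite -(ltr_pM2l (mulr_gt0 hyp nyp)).
have -> : hy * ny * (nz * hx) = ny * hx * (nz * hy) by ring.
have -> : hy * ny * (nx * hz) = nx * hy * (ny * hz) by ring.
exact: le_lt_trans lt.
Qed.

(* [dotv (ratio_dir x) (y - x) = N x H y - N y H x] compares the ratios H/N at
   x and y, where H is the height above B and N the depth below the root. *)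
Definition ratio_dir w (u0 : V) h (b : R) x : V :=
  (- dotv w (x - u0)) *: h + (dotv h x - b) *: w.

Lemma ratio_dirE w u0 h b x y : dotv (ratio_dir w u0 h b x) (y - x) =
  (- dotv w (x - u0)) * (dotv h y - b) - (- dotv w (y - u0)) * (dotv h x - b).
Proof. rewrite /ratio_dir !dotvE; lra. Qed.

(** Termination of the simplex method: the ratio strictly increases along its steps and there are
    finitely many vertices. *)
Lemma ratio_ind P S u0 w h (b : R) (Q : V -> Prop) : seteq P (conv S) ->
  (forall x, P x -> b <= dotv h x) ->
  (forall x, P x -> dotv w (x - u0) <= 0) ->
  (forall x, isVertex P x -> (forall y, isVertex P y ->
     0 < dotv (ratio_dir w u0 h b x) (y - x) -> Q y) -> Q x) ->
  forall x, isVertex P x -> Q x.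
Proof.
move=> eP hP wP step x xP.
pose r x y := 0 < dotv (ratio_dir w u0 h b x) (y - x).
have xS := vertex_in_gen eP xP; move: x xS xP.
apply: (@seq_strict_order_ind _ S r (fun x => isVertex P x -> Q x)).
- by move=> y; rewrite /r subrr dotv0r ltxx.
- move=> y z t yS zS tS; rewrite /r !ratio_dirE !subr_gt0.
  by apply: ratio_lt_trans; rewrite ?oppr_ge0 ?subr_ge0 ?wP ?hP //;
    apply/eP/conv_mem.
- move=> y yS IH yP; apply: step => // z zP lt; apply: IH => //.
  exact: vertex_in_gen zP.
Qed.

Lemma ratio_ind_rev P S u0 w h (b : R) (Q : V -> Prop) : seteq P (conv S) ->
  (forall x, P x -> b <= dotv h x) ->
  (forall x, P x -> dotv w (x - u0) <= 0) ->
  (forall x, isVertex P x -> (forall y, isVertex P y ->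
     dotv (ratio_dir w u0 h b x) (y - x) < 0 -> Q y) -> Q x) ->
  forall x, isVertex P x -> Q x.
Proof.
move=> eP hP wP step x xP.
pose r x y := dotv (ratio_dir w u0 h b x) (y - x) < 0.
have xS := vertex_in_gen eP xP; move: x xS xP.
apply: (@seq_strict_order_ind _ S r (fun x => isVertex P x -> Q x)).
- by move=> y; rewrite /r subrr dotv0r ltxx.
- move=> y z t yS zS tS; rewrite /r !ratio_dirE !subr_lt0 => lt1 lt2.
  by apply: (ratio_lt_trans _ _ _ _ _ _ lt2 lt1); rewrite ?oppr_ge0 ?subr_ge0 ?wP ?hP //;
    apply/eP/conv_mem.
- move=> y yS IH yP; apply: step => // z zP lt; apply: IH => //.
  exact: vertex_in_gen zP.
Qed.

Lemma vertex_strict_le P v a : (forall x, P x -> x != v -> dotv a (x - v) < 0) ->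
  forall x, P x -> dotv a (x - v) <= 0.
Proof.
by move=> h x Px; have [->|/(h x Px)/ltW] := eqVneq x v; rewrite ?subrr ?dotv0r.
Qed.

Lemma canopy_connected P B : polytope P -> isFace P B -> (exists x, P x /\ ~ B x) ->
  connectedG (canopyV P) (canopyE P B).
Proof.
move=> pP BP [x0 [Px0 nBx0]]; have [h [b [h1 h2]]] := face_height BP.
have [|u0 u0P u0max] := vertex_max h pP; first by exists x0.
have Pu0 := vertex_mem u0P.
have Hu0 : 0 < dotv h u0 - b.
  by have := height_off h1 h2 Px0 nBx0; have := u0max _ Px0; lra.
have [w wP] := vertex_strict u0P; have wle := vertex_strict_le wP.
case: (pP) => S eP.
have to_root v : isVertex P v -> reach (canopyE P B) v u0.
  move: v; apply: (ratio_ind (Q := fun v => reach (canopyE P B) v u0) eP h1 wle) => v vP IH.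
  have [->|ne] := eqVneq v u0; first exact: reach_refl.
  have Pv := vertex_mem vP; have Nv := wP v Pv ne.
  (* The root has denominator 0 and positive height, so it beats every other vertex and an improving
     edge exists. Its end is off B, because height 0 is never an improvement. *)
  have [|u [uP e gu]] := @edge_up _ _ P v u0 (ratio_dir w u0 h b v) pP vP Pu0.
    by rewrite ratio_dirE subrr dotv0r oppr0 mul0r subr0 mulr_gt0 // oppr_gt0.
  apply: reach_step (IH u uP gu); apply: canopyE_intro => //; right => Bu.
  have Pu := vertex_mem uP; move: gu; rewrite ratio_dirE (proj1 (h2 u Pu) Bu).
  rewrite subrr mulr0 sub0r oppr_gt0 ltNge mulr_ge0 // ?oppr_ge0 ?wle //.
  by rewrite subr_ge0 h1.
move=> u v uP vP; apply: reach_trans (to_root u uP) _.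
by apply: reach_sym (to_root v vP); apply: canopyE_sym.
Qed.

Lemma canopy_tree P B : pretreetope P B -> isTree (canopyV P) (canopyE P B).
Proof.
move=> pt; case: (pt) => pP [BP [neB _]]; split.
  by apply: vertex_exists => //; case: neB => x [Px _]; exists x.
split; first exact: canopy_graph.
by split; [apply: canopy_connected | apply: canopy_acyclic].
Qed.

(** The simplex method run downwards, with the ratio normalised at [u]. The point [f] has ratio 0,
    so every vertex off B has a descending edge; no descending step ends at [u], where the
    denominator is 0. *)
Lemma reach_base P B u f v : polytope P -> isFace P B -> isVertex P u ->
  B f -> f != u -> isVertex P v -> v != u ->
  exists2 t, B t /\ isVertex P t &
    reach (fun x y => canopyE P B x y /\ x != u /\ y != u) v t.
Proof.
move=> pP BP uP Bf fu; have [h [b [h1 h2]]] := face_height BP.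
have [w wP] := vertex_strict uP; have wle := vertex_strict_le wP.
have Pf := face_subset BP Bf; have Pu := vertex_mem uP.
case: (pP) => S eP; move: v.
pose E x y := canopyE P B x y /\ x != u /\ y != u.
apply: (ratio_ind_rev (Q := fun v => v != u ->
  exists2 t, B t /\ isVertex P t & reach E v t) eP h1 wle) => v vP IH vu.
have Pv := vertex_mem vP; have [Bv|nBv] := classic (B v).
  by exists v => //; exact: reach_refl.
have Hv : 0 < dotv h v - b by rewrite subr_gt0; apply: (height_off h1 h2 Pv).
have [|y [yP e gy]] := @edge_up _ _ P v f (- ratio_dir w u h b v) pP vP Pf.
  rewrite dotvNl ratio_dirE (proj1 (h2 f Pf) Bf) subrr mulr0 sub0r opprK.
  by rewrite mulr_gt0 // oppr_gt0 wP.
move: gy; rewrite dotvNl oppr_gt0 => gy.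
have yu : y != u.
  apply: contraTneq gy => ->; rewrite ratio_dirE subrr dotv0r oppr0 mul0r subr0.
  by rewrite -leNgt mulr_ge0 ?oppr_ge0 ?wle ?subr_ge0 ?h1.
have [t tB r] := IH y yP gy yu; exists t => //; apply: reach_step r.
by split=> //; apply: canopyE_intro => //; left.
Qed.

End Canopy.

(** * Lifts: dimension, existence, uniqueness and minimality *)

Section Lifts.
Variables (R : realFieldType) (n : nat).
Local Notation V := 'rV[R]_n.
Implicit Types (S T : seq V) (P F G B C : pset R n) (a c g x y v u s : V).

Lemma dotv_submx m (Y : 'M[R]_(m, n)) c x :
  (x <= Y)%MS -> (forall i, dotv c (row i Y) = 0) -> dotv c x = 0.
Proof.
have E z : dotv c z = (z *m c^T) 0 0.
  by rewrite mxE; apply: eq_bigr => i _; rewrite mxE mulrC.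
case/submxP => D -> h; rewrite E -mulmxA (_ : Y *m c^T = 0) ?mulmx0 ?mxE //.
by apply/row_matrixP => i; apply/rowP => j; rewrite row_mul row0 !ord1 -E h mxE.
Qed.

Lemma canopy_neighbour_exists P B v : pretreetope P B -> isVertex P v -> B v ->
  exists p, canopyE P B v p.
Proof.
move=> [pP [BP [[x0 [Px0 nBx0]] _]]] vP Bv; have [h [b [h1 h2]]] := face_height BP.
have hv := proj1 (h2 v (vertex_mem vP)) Bv.
have [|p [pV e gp]] := @edge_up _ _ P v x0 h pP vP Px0.
  by rewrite dotvDr dotvNr hv subr_gt0; apply: (height_off h1 h2 Px0 nBx0).
exists p; apply: canopyE_intro => //; right => Bp.
by move: gp; rewrite dotvDr dotvNr hv (proj1 (h2 p (vertex_mem pV)) Bp) subrr ltxx.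
Qed.

Lemma canopy_neighbour_unique P B v p q : pretreetope P B -> B v ->
  canopyE P B v p -> canopyE P B v q -> p = q.
Proof.
move=> pt Bv cp cq; case: (pt) => pP [BP _]; have [h [b [h1 h2]]] := face_height BP.
have vP := vertex_mem cp.1; have hv := proj1 (h2 v vP) Bv.
by apply: (canopy_up_unique pt h1 h2 cp cq); rewrite hv h1 //;
  [exact: vertex_mem cp.2.1 | exact: vertex_mem cq.2.1].
Qed.

(* P lies in the affine span of B and the unique canopy edge at v. *)
Lemma canopy_span P B v p c : pretreetope P B -> B v -> canopyE P B v p ->
  (forall y, B y -> dotv c (y - v) = 0) -> dotv c (p - v) = 0 ->
  forall x, P x -> dotv c (x - v) = 0.
Proof.
move=> pt Bv cp; case: (pt) => pP [BP _]; case: (pP) => S eP.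
have [vP [pV [ep _]]] := cp; have Pv := vertex_mem vP.
have [h [b [h1 h2]]] := face_height BP; have hv := proj1 (h2 v Pv) Bv.
have memP z : z \in S -> P z by move=> zS; apply/eP/conv_mem.
have hp : 0 < dotv h (p - v).
  rewrite dotvDr dotvNr hv subr_gt0.
  by apply: (height_off h1 h2 (vertex_mem pV)); apply: canopyE_not_in cp Bv.
have [a0 a0P] := vertex_strict vP; have [ap [adp zp]] := edge_adapted eP ep hp.
have hB z : B z -> dotv h (z - v) <= 0.
  move=> Bz; rewrite dotvDr dotvNr hv (proj1 (h2 z _) Bz) ?subrr //.
  exact: face_subset Bz.
have pv : p != v by rewrite eq_sym (canopyE_neq cp).
have pS := vertex_in_gen eP pV.
(* One inequality suffices, since it can also be applied to [- c]. *)
suff half c' : (forall y, B y -> dotv c' (y - v) = 0) -> dotv c' (p - v) = 0 ->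
    forall x, P x -> dotv c' (x - v) <= 0.
  move=> cB cpv x Px; apply/eqP; rewrite eq_le half //= -oppr_le0 -dotvNl.
  apply: half => // [y By|]; rewrite dotvNl; first by rewrite cB ?oppr0.
  by rewrite cpv oppr0.
move=> {c} {}cB cpv x Px; apply: (conv_le_rel eP _ Px) => s sS.
rewrite leNgt; apply/negP => cs.
have hs : 0 < dotv h (s - v).
  rewrite dotvDr dotvNr hv subr_gt0; apply: (height_off h1 h2 (memP s sS)).
  by move=> /cB e; rewrite e ltxx in cs.
(* The functional [c' + l *: a0] is negative on B away from v, so a tilt by [h] makes it adapted,
   and by [adapted_same_ray] it then vanishes at p. Eliminating [r] between the values at p and s
   gives [l * (1 + |X| + X) <= 0] by the choice of [l], which is impossible. *)
pose X := dotv a0 (s - v) * dotv h (p - v) - dotv a0 (p - v) * dotv h (s - v).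
pose l := dotv c' (s - v) * dotv h (p - v) / (1 + `|X|).
have X1 : 0 < 1 + `|X| by apply: ltr_wpDr.
have l0 : 0 < l by rewrite divr_gt0 ?mulr_gt0.
have lE : l * (1 + `|X|) = dotv c' (s - v) * dotv h (p - v).
  by rewrite divfK // gt_eqF.
have [||r [ad [t [tS ht zt]]]] := @adapted_exists _ _ S v h (c' + l *: a0).
- move=> z zS zv hz; have Pz := memP z zS.
  have hz0 : dotv h (z - v) = 0.
    by apply/eqP; rewrite eq_le hz dotvDr dotvNr hv subr_ge0 h1.
  have Bz : B z.
    apply/(h2 z Pz); move: hz0; rewrite dotvDr dotvNr hv => /eqP.
    by rewrite subr_eq0 => /eqP.
  by split; [rewrite dotvDl dotvZl cB // add0r pmulr_rlt0 // a0P | left].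
- by exists s.
have tv : t != v by apply: contraTneq ht => ->; rewrite subrr dotv0r ltxx.
have := adapted_same_ray pt eP Pv hB adp ad pS tS pv tv zp zt.
move/(congr1 (dotv (c' + l *: a0 + r *: h))); rewrite !dotvZr zt mulr0 => /eqP.
rewrite mulf_eq0 gt_eqF //= => /eqP; rewrite !dotvDl !dotvZl cpv add0r => e1.
have := ad.1 s sS; rewrite !dotvDl !dotvZl => e2.
have := ler_wpM2r (ltW hp) e2; have := congr1 ( *%R^~ (dotv h (s - v))) e1.
have := ler_wpM2l (ltW l0) (ler_norm (- X)); rewrite normrN /= mul0r.
rewrite /X in lE *; lra.
Qed.

(** A basis for B is extended by [p - x0], where p is the canopy neighbour of a vertex of B.
    Independence holds because [h] kills the directions of B but not [p - x0]; spanning is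
    [canopy_span]. *)
Lemma affdim_succ P B k : pretreetope P B -> affdim B k -> affdim P (k + 1).
Proof.
move=> pt [x0 [Bx0 [Y [h1 [h2 h3]]]]]; case: (pt) => pP [BP _].
have BsubP := face_subset BP; have [v vB] : exists v, isVertex B v.
  by apply: vertex_exists; [apply: face_polytope BP | exists x0].
have vP : isVertex P v by apply: face_vertex vB.
have Bv := vertex_mem vB; have [p cp] := canopy_neighbour_exists pt vP Bv.
have nBp := canopyE_not_in pP BP cp Bv; have Pp := vertex_mem cp.2.1.
have [h [b [k1 k2]]] := face_height BP.
have hB z : B z -> dotv h z = b by move=> Bz; apply: (k2 z (BsubP z Bz)).1.
exists x0; split; first exact: BsubP; exists (col_mx Y (p - x0)); split.
  move=> i; case: (splitP i) => j e.
    rewrite (_ : i = lshift 1 j); last exact: val_inj.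
    by rewrite rowKu; apply/BsubP/h1.
  rewrite (_ : i = rshift k j); last exact: val_inj.
  by rewrite rowKd row_id addrC subrK.
split.
  apply: inj_row_free => D; rewrite -[D]hsubmxK mul_row_col.
  set D1 := lsubmx D; set D2 := rsubmx D => e.
  have h0 : dotv h (D1 *m Y) = 0.
    apply: (dotv_submx (submxMl _ _)) => i.
    by have := hB _ (h1 i); rewrite dotvDr (hB x0) // => /eqP; rewrite addrC -subr_eq0 addrK => /eqP.
  have D2E : D2 *m (p - x0) = D2 0 0 *: (p - x0).
    by rewrite {1}[D2]mx11_scalar mul_scalar_mx.
  have D20 : D2 = 0.
    have := congr1 (dotv h) e; rewrite dotvDr h0 add0r dotv0r D2E dotvZr => /eqP.
    rewrite mulf_eq0 => /orP[/eqP z|].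
      by rewrite [D2]mx11_scalar z raddf0.
    rewrite dotvDr dotvNr (hB x0) // subr_eq0 => /eqP hp.
    by case: nBp; apply/k2.
  have D10 : D1 = 0.
    by apply: (row_free_inj h2); rewrite mul0mx -e D20 mul0mx addr0.
  by rewrite D10 D20 row_mx0.
move=> x Px; apply: dotv_cokermx => c ck.
have cY i : dotv c (row i Y) = 0.
  by have := ck (lshift 1 i); rewrite rowKu.
have cp0 : dotv c (p - x0) = 0.
  by have := ck (rshift k ord0); rewrite rowKd row_id.
have cB y : B y -> dotv c (y - x0) = 0 by move=> /h3 hy; apply: dotv_submx cY.
have shift y : dotv c (y - v) = dotv c (y - x0) - dotv c (v - x0).
  by rewrite -dotvNr -dotvDr opprB addrA subrK.
have := canopy_span (c := c) pt Bv cp _ _ Px; rewrite !shift (cB v Bv) !subr0.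
by apply => // y By; rewrite shift !cB ?subr0.
Qed.

(** A face of G is a face of P and meets B only inside F, so the treetope condition is inherited. *)
Lemma pretreetope_face P B G F : pretreetope P B -> isFace P G -> seteq (inter G B) F ->
  (exists x, G x /\ ~ F x) -> pretreetope G F.
Proof.
move=> [pP [BP [_ thin]]] GP eF nF.
split; first exact: face_polytope GP.
split; first by apply: isFace_ext (face_inter BP GP).
split=> // F' F'G small; apply: thin; first exact: face_trans F'G.
have sub x : inter F' B x -> inter F' F x.
  by move=> [F'x Bx]; split=> //; apply/eF; split=> //; apply: face_subset F'x.
by move=> x y /sub ? /sub ?; apply: small.
Qed.

Lemma canopyE_face P B G F v u : polytope P -> isFace P G -> seteq (inter G B) F ->
  canopyE G F v u -> canopyE P B v u.
Proof.
move=> pP GP eF [vG [uG [[eG eD] nF]]]; split; first exact: face_vertex vG.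
split; first exact: face_vertex uG.
split; first by split=> //; apply: face_trans eG.
move=> sub; apply: nF => x cx; apply/eF; split; [exact: face_subset cx | exact: sub].
Qed.

Lemma lift_exists P B F : polytope P -> isFace P B -> (exists x, P x /\ ~ B x) ->
  isFace B F -> exists G, [/\ isFace P G, seteq (inter G B) F & exists x, G x /\ ~ B x].
Proof.
move=> pP BP [x0 [Px0 nBx0]] [f [f0 [f1 f2]]]; case: (pP) => S eP.
have memP z : z \in S -> P z by move=> zS; apply/eP/conv_mem.
have [h [b [h1 h2]]] := face_height BP.
have [s0 s0S hs0] : exists2 s, s \in S & b < dotv h s.
  apply: NNPP => none; have := height_off h1 h2 Px0 nBx0; rewrite ltNge => /negP; apply.
  apply: conv_le ((eP x0).1 Px0) => s sS; rewrite leNgt; apply/negP => lt.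
  by apply: none; exists s.
(* The largest ratio [t] is the least tilt making [f - t *: h] at most [f0 - t * b] on generators
   off B, with equality at [s1]. On B the tilt shifts both sides equally, so the new face meets B in
   F. *)
have [s1] := @seq_argmin _ _ (fun s => - ((dotv f s - f0) / (dotv h s - b)))
  [seq s <- S | b < dotv h s] s0 ltac:(by rewrite mem_filter hs0).
rewrite mem_filter => /andP[hs1 s1S] sP; pose t := (dotv f s1 - f0) / (dotv h s1 - b).
have tE : dotv (f - t *: h) s1 = f0 - t * b.
  have e : t * (dotv h s1 - b) = dotv f s1 - f0 by rewrite divfK // gt_eqF // subr_gt0.
  by rewrite dotvDl dotvNl dotvZl; lra.
have le s : s \in S -> dotv (f - t *: h) s <= f0 - t * b.
  move=> sS; rewrite dotvDl dotvNl dotvZl.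
  have := h1 s (memP s sS); rewrite le_eqVlt => /predU1P[e|lt].
    by rewrite -e lerD2r f1 //; apply/(h2 s (memP s sS)).
  have := sP s; rewrite mem_filter lt sS lerN2 => /(_ isT).
  by rewrite ler_pdivrMr ?subr_gt0 // -/t; lra.
exists (fun x => P x /\ dotv (f - t *: h) x = f0 - t * b); split.
- exists (f - t *: h), (f0 - t * b); split=> // x /eP; exact: conv_le.
- move=> x; split=> [[[Px e] Bx]|/f2[Bx fx]].
    apply/f2; split=> //; move: e; rewrite dotvDl dotvNl dotvZl ((h2 x Px).1 Bx).
    exact: addIr.
  have Px := face_subset BP Bx.
  by split=> //; split=> //; rewrite dotvDl dotvNl dotvZl fx ((h2 x Px).1 Bx).
- exists s1; split; first by split=> //; apply: memP.
  by move/(h2 s1 (memP s1 s1S)) => e; rewrite e ltxx in hs1.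
Qed.

(** At a vertex v of F both faces contain the unique canopy edge vp of P. The functional of [G1] is
    constant on F and p, hence by [canopy_span] on all of [G2]. *)
Lemma lift_subset P B F G1 G2 : pretreetope P B -> isFace P G1 -> isFace P G2 ->
  seteq (inter G1 B) F -> seteq (inter G2 B) F -> nonempty F ->
  (exists x, G1 x /\ ~ F x) -> (exists x, G2 x /\ ~ F x) -> subsetP G2 G1.
Proof.
move=> pt G1P G2P e1 e2 neF off1 off2; case: (pt) => pP [BP _].
have pt1 := pretreetope_face pt G1P e1 off1.
have pt2 := pretreetope_face pt G2P e2 off2.
have pol1 := pt1.1; have [FG1 _] := pt1.2; have pol2 := pt2.1; have [FG2 _] := pt2.2.
have [v vF] : exists v, isVertex F v.
  by apply: vertex_exists => //; apply: face_polytope FG1.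
have Fv := vertex_mem vF; have [G1v Bv] := (e1 v).2 Fv.
have [p c1] := canopy_neighbour_exists pt1 (face_vertex pol1 FG1 vF) Fv.
have [q c2] := canopy_neighbour_exists pt2 (face_vertex pol2 FG2 vF) Fv.
have pq : p = q.
  by apply: (canopy_neighbour_unique pt Bv);
    [apply: canopyE_face c1 | apply: canopyE_face c2].
have G1p := vertex_mem c1.2.1; subst q.
case: (G1P) => a [b [h1 h2]].
have av z : G1 z -> dotv a (z - v) = 0.
  by move=> /h2[_ ez]; have /h2[_ ev] := G1v; rewrite dotvDr dotvNr ez ev subrr.
move=> x G2x; apply/h2; split; first exact: face_subset G2P x G2x.
have := canopy_span (c := a) pt2 Fv c2 _ (av p G1p) G2x; rewrite dotvDr dotvNr.
have /h2[_ ->] := G1v; move=> h; apply/eqP; rewrite -subr_eq0; apply/eqP/h.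
by move=> y /e1[G1y _]; apply: av.
Qed.

Lemma treetope_pretreetope P B : treetope P B -> pretreetope P B.
Proof.
move=> [pP [[BP [d [dP dB]]] thin]]; split=> //; split=> //; split=> //.
apply: NNPP => h; have e : seteq B P.
  move=> x; split=> [|Px]; first exact: face_subset.
  by apply: NNPP => nB; apply: h; exists x.
have := hasDim_inj dP (hasDim_ext e dB); lra.
Qed.

Lemma dim_ge1_two_points F d : hasDim F d -> 1 <= d -> exists x y, [/\ F x, F y & x != y].
Proof.
case=> [[-> _]|[k [-> h]]] // k1; apply: NNPP => none; have [x0 [Fx0 _]] := h.
have : affdim F 0.
  exists x0; split=> //; exists 0; split=> [[]//|].
  split=> [|x Fx]; first by rewrite /row_free mxrank0.
  suff -> : x = x0 by rewrite subrr sub0mx.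
  by apply/eqP; apply: contraT => ne; case: none; exists x, x0.
by move/(affdim_inj h) => k0; rewrite k0 in k1.
Qed.

Lemma canopy_min_subtree P B F G : treetope P B -> isFace P G ->
  seteq (inter G B) F -> treetope G F -> (exists x y, [/\ F x, F y & x != y]) ->
  isMinSubtree (canopyV P) (canopyE P B) (isVertex F) (canopyV G) (canopyE G F).
Proof.
move=> /treetope_pretreetope pt GP eF /treetope_pretreetope ptG [y1 [y2 [Fy1 Fy2 y12]]].
have pP := pt.1; have pG := ptG.1; have FG := ptG.2.1.
have subE u v : canopyE G F u v -> canopyE P B u v by apply: canopyE_face.
have treeG := canopy_tree ptG; have [_ [_ [conG _]]] := treeG.
split; first by split=> // v; apply: face_vertex.
split=> //; split; first by move=> v; apply: face_vertex.
move=> V' E' [subV' subE'] [_ [[gV' [gsym _]] [con' _]]] FV'.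
have edges u v : canopyE G F u v -> E' u v.
  move=> euv; apply: NNPP => nE.
  have [_ [psym pirr]] := canopy_graph P B.
  apply: (acyclic_bridge pirr psym (canopy_acyclic pt) (subE _ _ euv)).
  set E1 := fun x y => _; have uv := canopyE_neq euv.
  have E1sym x y : E1 x y -> E1 y x.
    by move=> [e ne]; split; [apply: psym | move=> [[]|[]] *; apply: ne; auto].
  (* [reach_base] needs a base point other than the vertex to be avoided; this is where F having two
     points enters. *)
  have other z : exists2 f, F f & f != z.
    by have [<-|ne] := eqVneq y1 z; [exists y2 => //; rewrite eq_sym | exists y1].
  have to_base w z : isVertex G w -> isVertex G z -> w != z -> (z = u \/ z = v) ->
      exists2 t, isVertex F t & reach E1 w t.
    move=> wG zG wz zuv; have [f Ff fz] := other z.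
    have [t [Ft tG] r] := reach_base pG FG zG Ff fz wG wz.
    exists t; first exact: vertex_face tG FG Ft.
    apply: reach_sub r => x y [/subE e [/eqP xz /eqP yz]]; split=> //.
    by case: zuv => zE; rewrite -zE; case=> -[].
  have [t1 t1F r1] := to_base u v euv.1 euv.2.1 uv (or_intror erefl).
  have [t2 t2F r2] := to_base v u euv.2.1 euv.1 ltac:(by rewrite eq_sym) (or_introl erefl).
  (* The ends [t1] and [t2] are joined inside the subtree, whose edges do not include uv, so u
     reaches v without it. *)
  apply: (reach_trans r1); apply: reach_trans (reach_sym E1sym r2).
  apply: (@reach_sub _ _ E'); last exact: con' (FV' _ t1F) (FV' _ t2F).
  move=> x y e; split; first exact: subE'.
  by case=> -[ex ey]; apply: nE; rewrite -ex -ey //; apply: gsym.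
(* A vertex of G other than [f] has a canopy edge of G, as G's canopy is connected, and that edge is
   already in the subtree. *)
split=> // v vG; have [f fF] : exists f, isVertex F f.
  by apply: vertex_exists; [apply: face_polytope FG | exists y1].
have [fv|ne] := eqVneq v f; first by rewrite fv; apply: FV'.
have [[|z s] [/= w l]] := conG v f vG (face_vertex pG FG fF).
  by rewrite l eqxx in ne.
by have [] := gV' _ _ (edges _ _ w.1).
Qed.

End Lifts.

(** * Assembly of the tree, the lifts and the three classes of faces *)

Theorem mainTheorem6 (R : realFieldType) (n : nat) (P B : pset R n) :
  treetope P B ->
  (* the canopy is a tree *)
  isTree (canopyV P) (canopyE P B) /\
  (* faces of B are faces of P (class (1) consists of faces of P) *)
  (forall F, isFace B F -> isFace P F) /\
  (* each nonempty face of B of dimension i has exactly one lift *)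
  (forall F i, isFace B F -> nonempty F -> hasDim F i ->
     exists G, (isFace P G /\ hasDim G (i + 1) /\ ~ seteq G F /\
                seteq (inter G B) F) /\
       forall G', isFace P G' -> hasDim G' (i + 1) -> ~ seteq G' F ->
                  seteq (inter G' B) F -> seteq G' G) /\
  (* the nonempty faces of P are partitioned into the three classes *)
  (forall G, isFace P G -> nonempty G ->
     let c1 := isFace B G in
     let c2 := (hasDim G 0 \/ hasDim G 1) /\ (forall x, G x -> ~ B x) in
     let c3 := exists F, isFace B F /\ nonempty F /\ isLift P B F G in
     (c1 \/ c2 \/ c3) /\ ~ (c1 /\ c2) /\ ~ (c1 /\ c3) /\ ~ (c2 /\ c3)) /\
  (* lifts of faces of B of dimension >= 1 *)
  (forall F G, isFace B F -> (exists d, hasDim F d /\ 1 <= d) ->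
     isLift P B F G ->
     treetope G F /\
     isMinSubtree (canopyV P) (canopyE P B) (isVertex F)
                  (canopyV G) (canopyE G F)).
Proof.
move=> tP; have pt := treetope_pretreetope tP; case: (pt) => pP [BP [offB thin]].
have off G F : seteq (inter G B) F -> ~ seteq G F -> exists x, G x /\ ~ F x.
  move=> e ne; apply: NNPP => none; apply: ne => x; split=> [Gx|/e[]//].
  by apply: NNPP => nF; apply: none; exists x.
have dimG G F k : isFace P G -> seteq (inter G B) F -> (exists x, G x /\ ~ F x) ->
    affdim F k -> hasDim G (k%:Z + 1).
  move=> GP e ne dF; right; exists (k + 1)%N; split; first by rewrite PoszD.
  by apply: affdim_succ dF; apply: (pretreetope_face pt GP e).
split; first exact: canopy_tree.
split; first by move=> F; apply: face_trans.
split.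
  move=> F i FB neF /(hasDim_nonempty neF)[k -> dF].
  have [G [GP eG [x [Gx nBx]]]] := lift_exists pP BP offB FB.
  have nF : exists x, G x /\ ~ F x by exists x; split=> // /eG[].
  have neq : ~ seteq G F by move=> h; case: nBx; have /eG[] := (h x).1 Gx.
  exists G; split; first by split=> //; split; first exact: dimG nF dF.
  move=> G' G'P _ neq' eG' y; have nF' := off _ _ eG' neq'.
  by split; [apply: (lift_subset pt GP G'P eG eG') | apply: (lift_subset pt G'P GP eG' eG)].
split.
  move=> G GP neG c1 c2 c3; split; last first.
    split; first by move=> [/face_subset h [_ h2]]; case: neG => x Gx; case: (h2 x Gx); apply: h.
    split.
      move=> [/face_subset h [F [_ [_ [_ [ne [e _]]]]]]]; apply: ne => x.
      by split=> [Gx|/e[]//]; apply/e; split=> //; apply: h.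
    move=> [[_ h] [F [_ [[x Fx] [_ [_ [e _]]]]]]].
    by have /e[Gx Bx] := Fx; apply: (h x).
  (* A face inside B is in the first class. One disjoint from B is in the second, by the treetope
     condition; any other is the lift of its intersection with B. *)
  have [nB|sub] := classic (exists x, G x /\ ~ B x); last first.
    left; apply: (face_sub_face GP); last exact: face_subset.
    by move=> x Gx; apply: NNPP => nB; apply: sub; exists x.
  right; have [ne|em] := classic (nonempty (inter G B)); last first.
    left; have no x : G x -> ~ B x by move=> Gx Bx; apply: em; exists x.
    have [|d [dG d1]] := thin _ GP; first by move=> x y [Gx Bx]; case: (no x).
    split=> //; have [[|[|k]] de _] := hasDim_nonempty neG dG; subst d => //; auto.
  have FG := face_inter BP GP; have FP : isFace P (inter G B) := face_trans pP GP FG.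
  right; exists (inter G B); split.
    by apply: (face_sub_face FP) => [x []|]; last exact: face_subset.
  split=> //; split=> //; case: nB => x [Gx nBx]; split.
    by move=> h; have [_ Bx] := (h x).1 Gx.
  split=> //; have [k dF] := affdim_exists (face_polytope pP FP) ne.
  exists k%:Z; split; first by right; exists k.
  by apply: dimG dF => //; exists x; split=> // -[].
move=> F G FB [d [dF d1]] [GP [ne [e [i [iF iG]]]]].
have two := dim_ge1_two_points dF d1.
have [polG [FG [_ thinG]]] := pretreetope_face pt GP e (off _ _ e ne).
(* That F is a facet of G comes from the dimension clause of [isLift]. *)
have tG : treetope G F.
  by split=> //; split=> //; split=> //; exists (i + 1); rewrite addrK.
by split=> //; apply: canopy_min_subtree two.
Qed.
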